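(* Let $\Omega\subset\mathbb{R}^n$ be a bounded Lipschitz domain and let $v\in\mathcal{V}_0(\Omega)$. Define $\Phi:\overline{\Omega}\to\mathbb{R}^n$ by $\Phi=F[v]$, the time-one map of the flow of $v$. Then $\Phi$ is a diffeomorphism (one-to-one and onto) in $\overline{\Omega}$.
   Context: $\Omega$ is connected. A Lipschitz domain has an outward unit normal $\mathbf{n}$ defined almost everywhere on $\partial\Omega$; conditions involving $\mathbf{n}$ are understood almost everywhere on $\partial\Omega$. $\mathcal{V}_0(\Omega)=\{v\in C^1(\overline{\Omega}\times[0,1];\mathbb{R}^n): v(\cdot,t)\cdot\mathbf{n}|_{\partial\Omega}=0\ \ \forall t\in[0,1]\}$, where $C^1$ means continuously differentiable up to the boundary. Flow: for $v\in\mathcal{V}_0(\Omega)$, the flow of $v$ is the map $X:\overline{\Omega}\times[0,1]\to\overline{\Omega}$ such that, for every $\xi\in\overline{\Omega}$, $\frac{\partial X}{\partial t}(\xi,t)=v(X(\xi,t),t)$ for $t\in(0,1]$ and $X(\xi,0)=\xi$. The time-one map is $F[v](\xi):=X(\xi,1)$. Diffeomorphism: a function $\Phi:\overline{\Omega}\to\mathbb{R}^n$ is a diffeomorphism in $\overline{\Omega}$, i.e. belongs to $\mathrm{Diff}(\overline{\Omega})$, if it is of class $C^1$ up to the boundary and is bijective (one-to-one and onto) in $\overline{\Omega}$. *)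

(* Defs.v *)
From mathcomp Require Import all_boot all_order all_algebra.
From mathcomp Require Import all_classical all_reals all_analysis.

Set Implicit Arguments.
Unset Strict Implicit.
Unset Printing Implicit Defensive.

Import Order.TTheory GRing.Theory Num.Theory.
Import numFieldNormedType.Exports.

Local Open Scope classical_set_scope.
Local Open Scope ring_scope.

(* The library norm on row vectors is the sup norm: it gives the right topology
   and the right Lipschitz functions, but lengths and angles need the
   Euclidean structure below. *)
Definition dotv (R : realType) (n : nat) (u w : 'rV[R]_n) : R :=
  \sum_(i < n) u 0 i * w 0 i.

Definition enorm (R : realType) (n : nat) (u : 'rV[R]_n) : R :=
  Num.sqrt (dotv u u).

Definition gradient (R : realType) (n : nat) (g : 'rV[R]_n -> R) (y : 'rV[R]_n)
    : 'rV[R]_n :=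
  \row_(i < n) 'D_(delta_mx 0 i) g y.

Definition boundary (T : topologicalType) (A : set T) : set T :=
  closure A `\` interior A.

(* Hausdorff measure, without the normalizing constant.  The gauges r i bound
   the diameters of the U i, so the infimum is the one over the diameters.
   For d = 0 this is the counting measure, as r ^+ 0 = 1 even if r = 0. *)
Definition hausdorff_pre (R : realType) (n d : nat) (delta : R)
    (A : set 'rV[R]_n) : \bar R :=
  ereal_inf [set s : \bar R |
    exists (I : set nat) (U : nat -> set 'rV[R]_n) (r : nat -> R),
    [/\ A `<=` \bigcup_(i in I) U i,
        forall i, I i -> 0 <= r i <= delta,
        forall i, I i -> forall x y, U i x -> U i y -> enorm (x - y) <= r i &
        s = \esum_(i in I) (r i ^+ d)%:E]].

Definition hausdorff_measure (R : realType) (n d : nat) (A : set 'rV[R]_n)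
    : \bar R :=
  ereal_sup [set hausdorff_pre d delta A | delta in [set delta : R | 0 < delta]].

Definition ae_boundary (R : realType) (n : nat) (Omega : set 'rV[R]_n.+1)
    (P : 'rV[R]_n.+1 -> Prop) : Prop :=
  hausdorff_measure n [set x | boundary Omega x /\ ~ P x] = 0%E.

(* Near p, in the orthonormal coordinates y = x *m Q, Omega is the strict
   hypograph y_0 < g(y_1, ..., y_n). *)
Definition lipschitz_graph_at (R : realType) (n : nat)
    (Omega : set 'rV[R]_n.+1) (p : 'rV[R]_n.+1) (r : R)
    (Q : 'M[R]_(1 + n)) (g : 'rV[R]_n -> R) : Prop :=
  [/\ 0 < r, Q *m Q^T = 1%:M, lipschitz g &
      forall x, ball p r x ->
        (Omega x <-> (x *m Q) 0 0 < g (rsubmx (x *m Q : 'rV[R]_(1 + n))))].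

Definition lipschitz_domain (R : realType) (n : nat)
    (Omega : set 'rV[R]_n.+1) : Prop :=
  [/\ open Omega, connected Omega, Omega !=set0 &
      forall p, boundary Omega p ->
        exists r Q g, lipschitz_graph_at Omega p r Q g].

(* In a graph chart the normal is (1, - grad g) / sqrt (1 + |grad g|^2),
   defined where g is differentiable, and rotated back by Q^T. *)
Definition outward_unit_normal (R : realType) (n : nat)
    (Omega : set 'rV[R]_n.+1) (x nu : 'rV[R]_n.+1) : Prop :=
  exists (r : R) (Q : 'M[R]_(1 + n)) (g : 'rV[R]_n -> R),
    let y := rsubmx (x *m Q : 'rV[R]_(1 + n)) in
    [/\ lipschitz_graph_at Omega x r Q g, differentiable g y &
        nu = (Num.sqrt (1 + dotv (gradient g y) (gradient g y)))^-1 *: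
             (row_mx 1%:M (- gradient g y) *m Q^T)].

(* C^1 on the open set A, the function and its derivatives having continuous
   extensions to the closure of A. *)
Definition C1_closure (R : realType) (V W : normedModType R) (A : set V)
    (f : V -> W) : Prop :=
  [/\ {within closure A, continuous f},
      forall x, A x -> differentiable f x &
      forall h : V, exists2 g : V -> W,
        {within closure A, continuous g} & forall x, A x -> 'D_h f x = g x].

(* The closure of Omega `*` `]0, 1[ is the closure of Omega times `[0, 1].
   The normal is only defined almost everywhere: for almost every x it exists
   and v (x, t) is orthogonal to it. *)
Definition V0 (R : realType) (n : nat) (Omega : set 'rV[R]_n.+1)
    (v : 'rV[R]_n.+1 * R -> 'rV[R]_n.+1) : Prop :=
  C1_closure (Omega `*` [set t : R | 0 < t < 1]) v /\
  forall t : R, 0 <= t <= 1 ->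
    ae_boundary Omega (fun x =>
      exists2 nu, outward_unit_normal Omega x nu & dotv (v (x, t)) nu = 0).

(* Only the values on closure Omega and [0, 1] matter.  The time derivative is
   relative to [0, 1], hence from the left at t = 1.  Continuity on [0, 1] is
   what ties the initial value to the equation, which is posed for t > 0. *)
Definition is_flow (R : realType) (n : nat) (Omega : set 'rV[R]_n.+1)
    (v : 'rV[R]_n.+1 * R -> 'rV[R]_n.+1)
    (X : 'rV[R]_n.+1 -> R -> 'rV[R]_n.+1) : Prop :=
  forall xi, closure Omega xi ->
    [/\ forall t, 0 <= t <= 1 -> closure Omega (X xi t),
        {within `[0, 1], continuous (X xi)},
        forall t, 0 < t <= 1 ->
          (s - t)^-1 *: (X xi s - X xi t)
            @[s --> within `[0, 1]%classic t^'] --> v (X xi t, t) &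
        X xi 0 = xi].

(* "The" flow as a definite description: if there were none, [get] would return
   the default element of the function type, so existence is not assumed. *)
Definition time_one_map (R : realType) (n : nat) (Omega : set 'rV[R]_n.+1)
    (v : 'rV[R]_n.+1 * R -> 'rV[R]_n.+1) (xi : 'rV[R]_n.+1) : 'rV[R]_n.+1 :=
  (get (is_flow Omega v : set ('rV[R]_n.+1 -> R -> 'rV[R]_n.+1))) xi 1.

Definition Diff (R : realType) (n : nat) (Omega : set 'rV[R]_n.+1)
    (Phi : 'rV[R]_n.+1 -> 'rV[R]_n.+1) : Prop :=
  C1_closure Omega Phi /\ set_bij (closure Omega) (closure Omega) Phi.

(* Main.v *)
(* Call w tangent to the boundary at y if y + h w stays within o(h) of the
   boundary as h -> 0.  Where the normal exists, orthogonality to it is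
   tangency, so v(., t) is tangent at almost every boundary point.  It is then
   tangent at every boundary point: in a graph chart y_0 < g(y'), tangency at
   (g(z), z) says that the derivative of g at z along v' is v_0, and by
   integrating over a family of parallel lines a null set is missed by lines
   arbitrarily close to any given one, up to small length; since v is
   continuous, the increment of the Lipschitz function g along such a line is
   controlled, and the control passes to the limit.

   A Lipschitz domain is locally quasi-convex, so v is Lipschitz in space and
   extends to a global Lipschitz field, whose integral curves exist.  By
   Nagumo's argument the compact boundary is invariant in both time directions,
   hence so are Omega and its closure.  Uniqueness and time reversal make the
   time-one map bijective; its differential solves the linearized equation, for
   which only the continuous extension of the spatial derivatives of v to the
   closure is needed. *)
Require Import Defs.
From mathcomp Require Import all_boot all_order all_algebra.
From mathcomp Require Import all_classical all_reals all_analysis.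
From mathcomp Require Import measurable_realfun.
From mathcomp Require Import ring lra.
Import Order.TTheory GRing.Theory Num.Theory.
Import numFieldNormedType.Exports.

Set Implicit Arguments.
Unset Strict Implicit.
Unset Printing Implicit Defensive.

Local Open Scope classical_set_scope.
Local Open Scope ring_scope.

(** * Differential inequalities *)

(** Curves are compared through one-sided growth bounds, because the quantities to be estimated,
    norms and the distance to the boundary, need not be differentiable; real induction propagates
    such a bound from left to right. Since the data live on [[0, 1]] and on the closure only, times
    are projected onto [[0, 1]] and all curves and fields are made global and continuous. The
    exceptional null set may change with [t], so tangency is established for each time separately.
    What shapes the last part is that [v] is only known to be differentiable in the open cylinder:
    an interior trajectory keeps a positive distance from the complement of [Omega], so segments to
    neighbouring trajectories stay in [Omega] and the mean value inequality applies. At boundary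
    points no differentiability is claimed; the linearized equation is solved along boundary
    trajectories too, and its continuous dependence on the trajectory provides the continuous
    extension of the derivatives demanded by [C1_closure]. *)

Lemma real_induction (R : realType) (a b : R) (P : R -> Prop) :
  P a ->
  (forall c, a < c <= b -> (forall s, a <= s < c -> P s) -> P c) ->
  (forall c, a <= c < b -> (forall s, a <= s <= c -> P s) ->
    exists2 e, 0 < e & forall s, c < s < c + e -> P s) ->
  forall s, a <= s <= b -> P s.
Proof.
move=> Pa Plim Pstep.
pose S := [set t | a <= t <= b /\ forall s, a <= s <= t -> P s].
move=> s0 s0ab; have ab : a <= b by lra.
have Sa : S a.
  split=> [|s sa]; first by lra.
  by have -> : s = a by lra.
have supS : has_sup S.
  split; first by exists a.
  by exists b => t [tab _]; lra.
(* The limit hypothesis gives [P c]; the step hypothesis then goes beyond [c] unless [c = b]. *)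
set c := sup S.
have ac : a <= c by apply: sup_upper_bound.
have cb : c <= b.
  by apply: sup_le_ub; [exists a | move=> t [tab _]; lra].
have below s : a <= s < c -> P s.
  move=> /andP[as_ sc].
  have [t [_ tP] st] := sup_adherent (eps := c - s) ltac:(by lra) supS.
  by apply: tP; rewrite as_ /=; move: st; rewrite -/c; lra.
have Pc : P c.
  move: ac; rewrite le_eqVlt => /predU1P[<- //|ac].
  by apply: Plim below; rewrite ac cb.
have upto s : a <= s <= c -> P s.
  move=> /andP[as_]; rewrite le_eqVlt => /predU1P[-> //|sc].
  by apply: below; rewrite as_ sc.
move: cb; rewrite le_eqVlt => /predU1P[cb|cb].
  by apply: upto; rewrite cb.
have [e e0 eP] := Pstep c ltac:(by rewrite ac cb) upto.
pose d := Num.min (e / 2) (b - c).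
have d0 : 0 < d by rewrite lt_min; apply/andP; split; lra.
have de : d <= e / 2 by rewrite ge_min lexx.
have db : d <= b - c by rewrite ge_min lexx orbT.
have : S (c + d).
  split=> [|s /andP[as_ scd]]; first by lra.
  have [sc|sc] := lerP s c; first by apply: upto; rewrite as_ sc.
  by apply: eP; lra.
by move=> /(sup_upper_bound supS); rewrite -/c => ?; lra.
Qed.

Lemma continuous_atP (R : realType) (V W : normedModType R) (f : V -> W) x :
  {for x, continuous f} <->
  forall e, 0 < e ->
    exists2 r, 0 < r & forall y, `|y - x| < r -> `|f y - f x| <= e.
Proof.
split=> [/cvgrPdist_le fx e e0|H].
  have /nbhs_normP[r /= r0 rP] := fx e e0; exists r => // y yx.
  by rewrite distrC; apply: rP; rewrite /= distrC.
apply/cvgrPdist_le => e e0; have [r r0 rP] := H e e0.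
by apply/nbhs_normP; exists r => // y /=; rewrite distrC => /rP; rewrite distrC.
Qed.

(** The step hypothesis speaks of interior points only, so that equations posed on open intervals
    suffice; leaving [a] relies on the strict inequality there and on continuity. *)
Lemma dini_compare (R : realType) (f m : R -> R) (a b : R) :
  continuous f -> continuous m -> f a < m a ->
  (forall c, a < c < b -> f c <= m c ->
    exists2 r, 0 < r & forall h, 0 < h < r -> f (c + h) <= m (c + h)) ->
  forall s, a <= s <= b -> f s <= m s.
Proof.
move=> cf cm fma step; apply: real_induction; first exact: ltW.
- move=> c cab below.
  have [//|mfc] := lerP (f c) (m c).
  have e0 : 0 < (f c - m c) / 4 by lra.
  have [r r0 rP] := (continuous_atP _ _).1 (cf c) _ e0.
  have [q q0 qP] := (continuous_atP _ _).1 (cm c) _ e0.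
  pose d := Num.min (Num.min (r / 2) (q / 2)) (c - a).
  have d0 : 0 < d by rewrite !lt_min; apply/andP; split; [apply/andP; split|]; lra.
  have dr : d <= r / 2 by rewrite !ge_min lexx.
  have dq : d <= q / 2 by rewrite !ge_min lexx orbT.
  have da : d <= c - a by rewrite !ge_min lexx !orbT.
  have cd : `|(c - d) - c| = d by rewrite addrAC subrr sub0r normrN gtr0_norm.
  have := below (c - d) ltac:(by lra).
  have := rP (c - d) ltac:(by rewrite cd; lra).
  have := qP (c - d) ltac:(by rewrite cd; lra).
  by rewrite !ler_norml; lra.
- move=> c cab upto; case: (eqVneq a c) => [<-|ac].
    have e0 : 0 < (m a - f a) / 4 by lra.
    have [r r0 rP] := (continuous_atP _ _).1 (cf a) _ e0.
    have [q q0 qP] := (continuous_atP _ _).1 (cm a) _ e0.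
    exists (Num.min r q); first by rewrite lt_min r0.
    move=> s /andP[as_ sa].
    have sr : s < a + r by apply: lt_le_trans sa _; rewrite lerD2l ge_min lexx.
    have sq : s < a + q.
      by apply: lt_le_trans sa _; rewrite lerD2l ge_min lexx orbT.
    have := rP s ltac:(by rewrite gtr0_norm; lra).
    have := qP s ltac:(by rewrite gtr0_norm; lra).
    by rewrite !ler_norml; lra.
  have acb : a < c < b by rewrite lt_neqAle ac.
  have [r r0 rP] := step c acb (upto c ltac:(by lra)).
  exists r => // s scr; have -> : s = c + (s - c) by ring.
  by apply: rP; lra.
Qed.

(** A division-free derivative: [h = 0] is allowed, and the remainder is a norm inequality ready to
    be added to others. *)
Definition has_deriv (R : realType) (V : normedModType R) (x : R -> V) (t : R)
    (d : V) : Prop :=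
  forall e, 0 < e -> exists2 r, 0 < r &
    forall h, `|h| < r -> `|x (t + h) - x t - h *: d| <= e * `|h|.

Lemma has_deriv_cst (R : realType) (V : normedModType R) (c : V) (t : R) :
  has_deriv (fun=> c) t 0.
Proof.
move=> e e0; exists 1 => // h _.
by rewrite scaler0 subrr subr0 normr0 mulr_ge0 // ltW.
Qed.

Lemma has_derivD (R : realType) (V : normedModType R) (x y : R -> V) t dx dy :
  has_deriv x t dx -> has_deriv y t dy ->
  has_deriv (fun s => x s + y s) t (dx + dy).
Proof.
move=> Hx Hy e e0.
have e20 : 0 < e / 2 by lra.
have [r r0 rP] := Hx _ e20; have [q q0 qP] := Hy _ e20.
exists (Num.min r q); first by rewrite lt_min r0.
move=> h; rewrite lt_min => /andP[hr hq].
have -> : x (t + h) + y (t + h) - (x t + y t) - h *: (dx + dy) =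
    (x (t + h) - x t - h *: dx) + (y (t + h) - y t - h *: dy).
  by rewrite scalerDr !opprD (addrACA (x _)) (addrACA (x _ - x _)).
apply: le_trans (ler_normD _ _) _.
have := rP h hr; have := qP h hq; lra.
Qed.

Lemma has_derivZ (R : realType) (V : normedModType R) (k : R) (x : R -> V) t d :
  has_deriv x t d -> has_deriv (fun s => k *: x s) t (k *: d).
Proof.
move=> Hx e e0.
have k0 : 0 < 1 + `|k| by have := normr_ge0 k; lra.
have [r r0 rP] := Hx (e / (1 + `|k|)) ltac:(by apply: divr_gt0).
exists r => // h hr.
rewrite scalerA mulrC -scalerA -!scalerBr normrZ.
apply: le_trans (_ : (1 + `|k|) * (e / (1 + `|k|) * `|h|) <= _).
  by apply: ler_pM => //; [lra | exact: rP].
by rewrite mulrA mulrCA mulfV ?mulr1 // gt_eqF.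
Qed.

Lemma has_derivN (R : realType) (V : normedModType R) (x : R -> V) t d :
  has_deriv x t d -> has_deriv (fun s => - x s) t (- d).
Proof.
move=> /(has_derivZ (-1)) H e /H [r r0 rP]; exists r => // h /rP.
by rewrite !scaleN1r.
Qed.

Lemma has_derivB (R : realType) (V : normedModType R) (x y : R -> V) t dx dy :
  has_deriv x t dx -> has_deriv y t dy ->
  has_deriv (fun s => x s - y s) t (dx - dy).
Proof. by move=> Hx Hy; apply: has_derivD => //; exact: has_derivN. Qed.

Lemma has_deriv_sum (R : realType) (V : normedModType R) (I : finType)
    (x : I -> R -> V) t (d : I -> V) :
  (forall i, has_deriv (x i) t (d i)) ->
  has_deriv (fun s => \sum_i x i s) t (\sum_i d i).
Proof.
move=> H; rewrite /index_enum; elim: (Finite.enum _) => [|i s IH] /=.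
  move=> e e0; exists 1 => // h _.
  by rewrite !big_nil scaler0 !subr0 normr0 mulr_ge0 // ltW.
move=> e e0; have [r r0 rP] := has_derivD (H i) IH e0.
by exists r => // h /rP; rewrite !big_cons.
Qed.

Lemma has_deriv_near (R : realType) (V : normedModType R) (x y : R -> V) t d r :
  0 < r -> (forall s, `|s - t| < r -> x s = y s) ->
  has_deriv x t d -> has_deriv y t d.
Proof.
move=> r0 xy H e /H [q q0 qP]; exists (Num.min r q); first by rewrite lt_min r0.
move=> h; rewrite lt_min => /andP[hr hq].
rewrite -!xy ?subrr ?normr0 //; first exact: qP.
by rewrite addrAC subrr add0r.
Qed.

Lemma has_deriv_reverse (R : realType) (V : normedModType R) (x : R -> V) c t d :
  has_deriv x (c - t) d -> has_deriv (fun s => x (c - s)) t (- d).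
Proof.
move=> H e /H [r r0 rP]; exists r => // h hr.
have := rP (- h); rewrite !normrN => /(_ hr).
by rewrite scalerN scaleNr opprK opprD addrA.
Qed.

(** The norm of a curve may fail to be differentiable, but the triangle inequality still bounds its
    growth rate to the right by [|d|]. *)
Lemma dini_norm (R : realType) (V : normedModType R) (x : R -> V) t d e :
  has_deriv x t d -> 0 < e ->
  exists2 r, 0 < r & forall h, 0 < h < r ->
    `|x (t + h)| <= `|x t| + h * (`|d| + e).
Proof.
move=> H /H [r r0 rP]; exists r => // h /andP[h0 hr].
have := rP h; rewrite gtr0_norm // => /(_ hr) H1.
have -> : x (t + h) = x (t + h) - x t - h *: d + (x t + h *: d).
  by rewrite -(addrA (x (t + h)) (- x t)) -opprD subrK.
apply: le_trans (ler_normD _ _) _.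
have := ler_normD (x t) (h *: d); rewrite normrZ gtr0_norm //; lra.
Qed.

(** The comparison function [m] grows at rate [L + 1] and stays above [e0] plus the error, so the
    extra unit in the rate pays for the inhomogeneous term. The bound is not sharp, but it involves
    no division by [L]. *)
Lemma gronwall (R : realType) (f : R -> R) (a b L e0 : R) :
  continuous f -> (forall t, 0 <= f t) -> 0 <= L -> 0 <= e0 ->
  (forall t e, a < t < b -> 0 < e -> exists2 r, 0 < r &
    forall h, 0 < h < r -> f (t + h) <= f t + h * (L * f t + e0 + e)) ->
  forall t, a <= t <= b -> f t <= (f a + e0) * expR ((L + 1) * (t - a)).
Proof.
move=> cf f0 L0 e00 H t tab; apply/ler_addgt0Pr => eta eta0.
pose E s := expR ((L + 1) * (s - a)).
have cE : continuous E.
  move=> s; apply: continuous_comp; last exact: continuous_expR.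
  apply: continuousM; first exact: cst_continuous.
  by apply: continuousB => //; exact: cst_continuous.
(* Scaled so that the error contributes exactly [eta] at the final time [t]. *)
pose et := eta / E t.
have Et0 : 0 < E t by exact: expR_gt0.
have et0 : 0 < et by exact: divr_gt0.
have -> : eta = et * E t by rewrite /et divfK // gt_eqF.
rewrite -mulrDl.
pose m s := (f a + e0 + et) * E s.
apply: (@dini_compare _ f m a b) tab => //.
- by move=> s; apply: cvgM; [exact: cvg_cst | exact: cE].
- by rewrite /m /E subrr mulr0 expR0 mulr1; lra.
move=> c cab fmc; have [r r1 rP] := H c et cab et0.
exists r => // h hr; apply: le_trans (rP h hr) _.
have h0 : 0 < h by lra.
have E1 : 1 <= E c by rewrite -[leLHS]expR0 ler_expR; apply: mulr_ge0; lra.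
have ED : m (c + h) = m c * expR ((L + 1) * h).
  rewrite /m /E -mulrA -expRD; congr (_ * expR _); ring.
have E2 : 1 + (L + 1) * h <= expR ((L + 1) * h) by exact: expR_ge1Dx.
have A0 : e0 + et <= m c.
  apply: le_trans (_ : (f a + e0 + et) * 1 <= _).
    by rewrite mulr1; have := f0 a; lra.
  by apply: ler_wpM2l => //; have := f0 a; lra.
have m0 : 0 <= m c by lra.
rewrite ED; apply: le_trans (_ : m c * (1 + (L + 1) * h) <= _); last first.
  exact: ler_wpM2l.
have h1 : h * (L * f c + e0 + et) <= h * (L * m c + m c).
  apply: ler_wpM2l; first exact: ltW.
  by rewrite -addrA; apply: lerD => //; exact: ler_wpM2l.
lra.
Qed.

Lemma gronwall_curve (R : realType) (V : normedModType R) (z : R -> V)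
    (a b L e0 : R) :
  continuous z -> 0 <= L -> 0 <= e0 ->
  (forall t, a < t < b -> exists2 d, has_deriv z t d & `|d| <= L * `|z t| + e0) ->
  forall t, a <= t <= b -> `|z t| <= (`|z a| + e0) * expR ((L + 1) * (t - a)).
Proof.
move=> cz L0 e00 H; apply: gronwall => //.
- by move=> t; apply: continuous_comp; [exact: cz | exact: norm_continuous].
- move=> t e tab e1; have [d Hd dL] := H t tab.
  have [r r0 rP] := dini_norm Hd e1; exists r => // h hr.
  apply: le_trans (rP h hr) _; rewrite lerD2l; apply: ler_wpM2l; lra.
Qed.

(** A mean value inequality with a majorant [m]: linear for increments of [v] along segments,
    exponential for the contraction estimate in [picard]. *)
Lemma norm_increment_le (R : realType) (V : normedModType R) (z : R -> V)
    (m m' : R -> R) (a b : R) :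
  a <= b -> continuous z -> continuous m ->
  (forall t, a < t < b -> has_deriv m t (m' t) /\
    exists2 d, has_deriv z t d & `|d| <= m' t) ->
  `|z b - z a| <= m b - m a.
Proof.
move=> ab cz cm H; apply/ler_addgt0Pr => eta eta0.
pose et := eta / (1 + (b - a)).
have et0 : 0 < et by apply: divr_gt0 => //; lra.
(* The slope [et] makes room for the two first-order remainders, and the summand 1 makes the
   inequality strict at [a]. *)
pose n s := m s - m a + et * (1 + (s - a)).
have -> : m b - m a + eta = n b.
  by rewrite /n /et divfK // gt_eqF //; lra.
apply: (@dini_compare _ (fun s => `|z s - z a|) n a b); last by lra.
- move=> s; apply: (@continuous_comp _ _ _ (fun s => z s - z a)).
    by apply: continuousB; [exact: cz | exact: cst_continuous].
  exact: norm_continuous.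
- move=> s; apply: cvgD; first by apply: cvgB; [exact: cm | exact: cvg_cst].
  apply: cvgM; first exact: cvg_cst.
  apply: cvgD; first exact: cvg_cst.
  by apply: cvgB; [exact: cvg_id | exact: cvg_cst].
- by rewrite /n !subrr normr0 addr0 mulr1 add0r.
move=> c cab fnc; have [Hm [d Hz dm]] := H c cab.
have e20 : 0 < et / 2 by lra.
have [r r0 rP] := Hm _ e20.
have Hz' : has_deriv (fun s => z s - z a) c d.
  move=> e /Hz [q q0 qP]; exists q => // h /qP.
  by rewrite opprB addrA subrK.
have [q q0 qP] := dini_norm Hz' e20.
exists (Num.min r q); first by rewrite lt_min r0.
move=> h /andP[h0]; rewrite lt_min => /andP[hr hq].
have := rP h; rewrite gtr0_norm // => /(_ hr); rewrite ler_norml => /andP[r1 _].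
have := qP h ltac:(by rewrite h0 hq) => q1.
have hd : h * (`|d| + et / 2) <= h * (m' c + et / 2).
  by apply: ler_wpM2l; lra.
move: fnc r1; rewrite /n /GRing.scale /=; lra.
Qed.

(** * Integral curves of Lipschitz fields *)

Lemma ler_norm_coord (R : realType) (m : nat) (x : 'rV[R]_m) i : `|x 0 i| <= `|x|.
Proof.
rewrite [leRHS]/Num.Def.normr /= mx_normrE.
exact: (le_bigmax _ (fun j : 'I_1 * 'I_m => `|x j.1 j.2|) (0, i)).
Qed.

Lemma rV_norm_leP (R : realType) (m : nat) (x : 'rV[R]_m) (e : R) : 0 <= e ->
  (forall i, `|x 0 i| <= e) -> `|x| <= e.
Proof.
move=> e0 H; rewrite /Num.Def.normr /= mx_normrE.
by apply: bigmax_le => // -[i j] _ /=; rewrite ord1.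
Qed.

Lemma derivable_has_deriv (R : realType) (V W : normedModType R) (f : V -> W)
    a v s :
  derivable f (a + s *: v) v ->
  has_deriv (fun s => f (a + s *: v)) s ('D_v f (a + s *: v)).
Proof.
move=> /cvgrPdist_le H e e0.
have /nbhs_normP[r /= r0 rP] := H e e0.
exists r => // h hr; case: (eqVneq h 0) => [->|h0].
  by rewrite addr0 subrr scale0r subrr !normr0 mulr0.
have := rP h; rewrite /= sub0r normrN => /(_ hr h0).
rewrite distrC -(ler_pM2r (_ : 0 < `|h|)) ?normr_gt0 //.
rewrite [X in X <= _]mulrC -normrZ scalerBr scalerA mulfV // scale1r.
have -> : a + (s + h) *: v = h *: v + (a + s *: v).
  by rewrite addrCA scalerDl (addrC (h *: v)).
exact.
Qed.

(** The integral starts at -1 so that 0 is an interior point, where the fundamental theorem gives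
    differentiability and hence continuity; composing with [Num.max t 0] freezes the primitive for
    [t <= 0]. *)
Lemma antiderivative (R : realType) (f : R -> R) : continuous f ->
  exists F : R -> R, [/\ continuous F, forall t, t <= 0 -> F t = 0 &
    forall t, 0 < t -> has_deriv F t (f t)].
Proof.
move=> cf.
pose G x := (\int[lebesgue_measure]_(t in `[(-1 : R), x]) (f t))%R.
have GD x : -1 < x -> derivable G x 1 /\ derive1 G x = f x.
  move=> x1; apply: (@continuous_FTC1_closed R f (-1) x (x + 1)) => //.
  - by rewrite ltrDl.
  - apply: continuous_compact_integrable; first exact: segment_compact.
    exact: continuous_subspaceT.
  - exact: cf.
have GH x : -1 < x -> has_deriv G x (f x).
  move=> x1; have [dG <-] := GD x x1; rewrite derive1E.
  have E y : 0 + y *: (1 : R) = y by rewrite add0r /GRing.scale /= mulr1.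
  have := @derivable_has_deriv R R R G 0 1 x; rewrite E => /(_ dG).
  by apply: (@has_deriv_near _ _ _ _ _ _ 1) => // s _; rewrite E.
exists (fun t => G (Num.max t 0) - G 0); split.
- move=> t; apply: cvgB; last exact: cvg_cst.
  apply: (@continuous_comp _ _ _ (fun t : R => Num.max t 0) G).
    by apply: continuous_max => //; exact: cst_continuous.
  apply: differentiable_continuous; apply/derivable1_diffP.
  by have [] := GD (Num.max t 0) ltac:(by rewrite lt_max ltrN10 orbT).
- by move=> t t0; rewrite max_r // subrr.
- move=> t t0; rewrite -[f t]subr0.
  apply: (@has_derivB R R (fun t => G (Num.max t 0)) (fun=> G 0)).
    apply: (has_deriv_near t0 _ (GH t _)); last by lra.
    by move=> s; rewrite ltr_norml => /andP[s1 _]; rewrite max_l //; lra.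
  exact: has_deriv_cst.
Qed.

Lemma antiderivative_rV (R : realType) (m : nat) (f : R -> 'rV[R]_m) :
  continuous f ->
  exists F : R -> 'rV[R]_m, [/\ continuous F, forall t, t <= 0 -> F t = 0 &
    forall t, 0 < t -> has_deriv F t (f t)].
Proof.
move=> cf.
have H (i : 'I_m) : exists F : R -> R, [/\ continuous F,
    forall t, t <= 0 -> F t = 0 & forall t, 0 < t -> has_deriv F t (f t 0 i)].
  apply: (@antiderivative R (fun t => f t 0 i)) => t.
  apply: (@continuous_comp _ _ _ f (fun x : 'rV[R]_m => x 0 i)); first exact: cf.
  exact: coord_continuous.
have [F FP] := choice H.
(* Radii can be shrunk, so the least of finitely many serves all coordinates; the initial value 1 of
   the minimum covers the empty family. *)
have common (I : finType) (P : I -> R -> Prop) :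
    (forall i, exists2 r, 0 < r & forall s, 0 < s -> s <= r -> P i s) ->
    exists2 r, 0 < r & forall i, P i r.
  move=> H'; have /choice[r rP] : forall i, exists r, 0 < r /\
      forall s, 0 < s -> s <= r -> P i s.
    by move=> i; have [r r0 rP] := H' i; exists r.
  have min0 : 0 < \big[Num.min/1]_i r i.
    by apply: lt_bigmin => // i _; have [] := rP i.
  exists (\big[Num.min/1]_i r i) => // i.
  by have [_ riP] := rP i; apply: riP => //; exact: bigmin_le_cond.
exists (fun t => \row_i F i t); split.
- move=> t; apply/continuous_atP => e e0.
  pose P i (r : R) := forall y, `|y - t| < r -> `|F i y - F i t| <= e.
  have [|r r0 rP] := common _ P.
    move=> i; have [cF _ _] := FP i.
    have [r r0 rP] := (continuous_atP _ _).1 (cF t) _ e0.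
    by exists r => // s s0 sr y ys; apply: rP; apply: lt_le_trans ys sr.
  exists r => // y yr; apply: rV_norm_leP; first exact: ltW.
  by move=> i; rewrite !mxE; exact: rP.
- by move=> t t0; apply/rowP => i; rewrite !mxE; have [_ ->] := FP i.
- move=> t t0 e e0.
  pose P i (r : R) := forall h, `|h| < r ->
    `|F i (t + h) - F i t - h *: f t 0 i| <= e * `|h|.
  have [|r r0 rP] := common _ P.
    move=> i; have [_ _ /(_ t t0 e e0)[r r0 rP]] := FP i.
    by exists r => // s s0 sr h hs; apply: rP; apply: lt_le_trans hs sr.
  exists r => // h hr; apply: rV_norm_leP; first by rewrite mulr_ge0 // ltW.
  by move=> i; rewrite !mxE; exact: rP.
Qed.

Lemma expr_half_lt (R : realType) (c e : R) : 0 < e ->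
  exists k, c * (2^-1) ^+ k <= e.
Proof.
move=> e0.
have : (geometric (`|c| + 1) (2^-1 : R)) @ \oo --> (0 : R).
  by apply: cvg_geometric; rewrite ger0_norm ?invr_ge0 // invf_lt1 // ltr1n.
move=> /cvgrPdist_le /(_ e e0) [k _ /(_ k (leqnn k))].
rewrite /geometric /= sub0r normrN ger0_norm; last first.
  by rewrite mulr_ge0 // ?addr_ge0 // exprn_ge0 // invr_ge0.
move=> H; exists k; apply: le_trans H.
apply: ler_wpM2r; first by rewrite exprn_ge0 // invr_ge0.
by have := ler_norm c; lra.
Qed.

(** The explicit rate is kept for the limit: it makes the limit of the Picard iterates continuous
    and lets the equation pass to the limit. *)
Lemma geometric_limit (R : realType) (m : nat) (u : nat -> 'rV[R]_m) (c : R) :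
  0 <= c -> (forall k, `|u k.+1 - u k| <= c * (2^-1) ^+ k) ->
  exists l, forall k, `|u k - l| <= 2 * c * (2^-1) ^+ k.
Proof.
move=> c0 H.
have tail k n : `|u (k + n)%N - u k| <= 2 * c * (2^-1) ^+ k - 2 * c * (2^-1) ^+ (k + n).
  elim: n => [|n IH]; first by rewrite addn0 !subrr normr0.
  have -> : u (k + n.+1)%N - u k = (u (k + n).+1 - u (k + n)%N) + (u (k + n)%N - u k).
    by rewrite addnS addrA subrK.
  apply: le_trans (ler_normD _ _) _.
  by have := H (k + n)%N; rewrite addnS exprS; lra.
have tail' k n : (k <= n)%N -> `|u n - u k| <= 2 * c * (2^-1) ^+ k.
  move=> /subnKC <-; apply: le_trans (tail _ _) _.
  by rewrite gerBl; rewrite !mulr_ge0 // exprn_ge0 // invr_ge0.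
have : cvg (u @ \oo).
  apply: cauchy_cvg; apply: cauchy_exP => e e0.
  have [k kP] := @expr_half_lt R (2 * c) (e / 2) ltac:(by lra).
  exists (u k); exists k => // n /= kn.
  rewrite -ball_normE /= distrC; apply: le_lt_trans (tail' _ _ kn) _; lra.
move=> /cvg_ex[l /cvgrPdist_le ul]; exists l => k.
apply/ler_addgt0Pr => e e0; have [n _ nP] := ul e e0.
have := nP (maxn n k) (leq_maxl _ _).
have := tail' k (maxn n k) (leq_maxr _ _).
have -> : u k - l = (u k - u (maxn n k)) + (u (maxn n k) - l) by rewrite addrA subrK.
move=> h1 h2; apply: le_trans (ler_normD _ _) _.
by rewrite [X in X + _]distrC [X in _ + X]distrC; exact: lerD.
Qed.

Lemma has_deriv_expR (R : realType) (k t : R) :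
  has_deriv (fun s => expR (k * s)) t (k * expR (k * t)).
Proof.
move=> e e0; pose E s := expR (k * s).
have dE : derivable E t 1 by [].
have DE : 'D_1 E t = k * expR (k * t).
  by rewrite /E derive_val /GRing.scale /=; ring.
have Ey y : 0 + y *: (1 : R) = y by rewrite add0r /GRing.scale /= mulr1.
have := @derivable_has_deriv R R R E 0 1 t; rewrite Ey => /(_ dE e e0).
by move=> [r r0 rP]; exists r => // h /rP; rewrite !Ey DE.
Qed.

(** Bielecki's weight: measured against [E t], an exponential of rate [2 * (L + 1)], each Picard
    step at least halves the distance of two iterates, so the iteration converges for all positive
    times at once. *)
Lemma picard (R : realType) (m : nat) (F : 'rV[R]_m -> R -> 'rV[R]_m)
    (L M : R) (xi : 'rV[R]_m) :
  0 <= L -> (forall x y t, `|F x t - F y t| <= L * `|x - y|) ->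
  (forall x, continuous (F x)) -> (forall t, `|F xi t| <= M) ->
  exists x : R -> 'rV[R]_m, [/\ continuous x, forall t, t <= 0 -> x t = xi &
    forall t, 0 < t -> has_deriv x t (F (x t) t)].
Proof.
move=> L0 FL cF FM.
have M0 : 0 <= M by apply: le_trans (FM 0).
have cFx (x : R -> 'rV[R]_m) : continuous x -> continuous (fun t => F (x t) t).
  move=> cx t; apply/continuous_atP => e e0.
  have d0 : 0 < e / 2 / (L + 1) by rewrite !divr_gt0 //; lra.
  have [r r0 rP] := (continuous_atP _ _).1 (cx t) _ d0.
  have e20 : 0 < e / 2 by lra.
  have [q q0 qP] := (continuous_atP _ _).1 (cF (x t) t) _ e20.
  exists (Num.min r q); first by rewrite lt_min r0.
  move=> y; rewrite lt_min => /andP[yr yq].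
  have -> : F (x y) y - F (x t) t = (F (x y) y - F (x t) y) + (F (x t) y - F (x t) t).
    by rewrite addrA subrK.
  apply: le_trans (ler_normD _ _) _.
  have h1 : `|F (x y) y - F (x t) y| <= e / 2.
    apply: le_trans (FL _ _ _) _.
    apply: le_trans (_ : (L + 1) * (e / 2 / (L + 1)) <= _).
      by apply: ler_pM => //; [lra | exact: rP].
    by rewrite mulrC divfK // gt_eqF //; lra.
  by have := qP y yq; lra.
(* A primitive vanishing for [t <= 0]; the default 0 would be returned only if there were none,
   which continuity of [f] excludes. *)
pose I (f : R -> 'rV[R]_m) := xget (fun=> 0) [set G : R -> 'rV[R]_m |
  [/\ continuous G, forall t, t <= 0 -> G t = 0 &
    forall t, 0 < t -> has_deriv G t (f t)]].
have IP f : continuous f -> [/\ continuous (I f), forall t, t <= 0 -> I f t = 0 &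
    forall t, 0 < t -> has_deriv (I f) t (f t)].
  by move=> /antiderivative_rV H; exact: (xgetPex (fun=> 0) H).
pose X := fix X k := if k is k'.+1 then (fun t => xi + I (fun s => F (X k' s) s) t)
  else (fun=> xi).
have cX k : continuous (X k).
  elim: k => [|k IH] /=; first exact: cst_continuous.
  have [cI _ _] := IP _ (cFx _ IH).
  by move=> t; apply: cvgD; [exact: cvg_cst | exact: cI].
have X0 k t : t <= 0 -> X k t = xi.
  by case: k => [//|k] t0 /=; have [_ -> //] := IP _ (cFx _ (cX k)); rewrite addr0.
(* The added 1 keeps the rate positive when [L = 0], and the first step of the iteration needs
   [M <= 2 * M * L']. *)
pose L' := L + 1.
pose E t := expR (2 * L' * t).
have E0 t : 0 < E t by exact: expR_gt0.
have cE : continuous E.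
  move=> s; apply: continuous_comp; last exact: continuous_expR.
  by apply: continuousM => //; exact: cst_continuous.
have dE c t : has_deriv (fun s => c * E s) t (c * (2 * L' * E t)).
  apply: (@has_derivZ _ R); exact: has_deriv_expR.
have growth c t : 0 < t -> 0 <= c -> forall y w dy dw : R -> 'rV[R]_m,
    continuous y -> continuous w -> y 0 = w 0 ->
    (forall s, 0 < s -> has_deriv y s (dy s)) ->
    (forall s, 0 < s -> has_deriv w s (dw s)) ->
    (forall s, 0 < s -> `|dy s - dw s| <= 2 * c * L' * E s) ->
    `|y t - w t| <= c * E t.
  move=> t0 c0 y w dy dw cy cw yw Hy Hw B.
  have := @norm_increment_le R 'rV[R]_m (fun s => y s - w s) (fun s => c * E s)
    (fun s => c * (2 * L' * E s)) 0 t (ltW t0).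
  rewrite yw subrr subr0 => H.
  have cc : 0 <= c * E 0 by rewrite mulr_ge0 // ltW.
  suff : `|y t - w t| <= c * E t - c * E 0 by lra.
  apply: H.
  - by move=> s; apply: cvgB; [exact: cy | exact: cw].
  - by move=> s; apply: cvgM; [exact: cvg_cst | exact: cE].
  - move=> s /andP[s0 _]; split; first exact: dE.
    exists (dy s - dw s); first by apply: has_derivB; [exact: Hy | exact: Hw].
    by apply: le_trans (B s s0) _; lra.
have dX k t : 0 < t -> has_deriv (X k.+1) t (F (X k t) t).
  move=> t0; have [_ _ H] := IP _ (cFx _ (cX k)).
  rewrite -[F _ _]add0r /=; apply: (@has_derivD R 'rV[R]_m (fun=> xi)); last exact: H.
  exact: has_deriv_cst.
have half k : 0 <= (2^-1 : R) ^+ k by rewrite exprn_ge0 // invr_ge0.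
have step k t : 0 < t -> `|X k.+1 t - X k t| <= M * (2^-1) ^+ k * E t.
  elim: k t => [|k IH] t t0.
    apply: (growth (M * 2^-1 ^+ 0) t t0 _ (X 1%N) (fun=> xi) (fun s => F xi s)
      (fun=> 0)) => //.
    - by rewrite expr0 mulr1.
    - exact: cst_continuous.
    - exact: X0.
    - by move=> s s0; exact: (dX 0%N).
    - by move=> s s0; exact: has_deriv_cst.
    - move=> s s0; rewrite subr0 expr0 mulr1; apply: le_trans (FM s) _.
      have E1 : 1 <= E s.
        by rewrite -[leLHS]expR0 ler_expR !mulr_ge0 // /L'; lra.
      rewrite -[leLHS]mulr1; apply: ler_pM => //.
      rewrite /L'; have := mulr_ge0 M0 L0; lra.
  apply: (growth (M * 2^-1 ^+ k.+1) t t0 _ (X k.+2) (X k.+1)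
    (fun s => F (X k.+1 s) s) (fun s => F (X k s) s)).
  - by rewrite mulr_ge0.
  - exact: cX.
  - exact: cX.
  - by rewrite !X0.
  - by move=> s s0; exact: dX.
  - by move=> s s0; exact: dX.
  - move=> s s0; apply: le_trans (FL _ _ _) _.
    apply: le_trans (_ : L' * (M * 2^-1 ^+ k * E s) <= _).
      by apply: ler_pM => //; [rewrite /L'; lra | exact: IH].
    by rewrite exprS; lra.
pose c t := M * E (Num.max t 0).
have c0 t : 0 <= c t by rewrite mulr_ge0 // ltW.
have stepc t k : `|X k.+1 t - X k t| <= c t * 2^-1 ^+ k.
  have [t0|t0] := lerP t 0.
    by rewrite !X0 // subrr normr0 mulr_ge0.
  by rewrite /c max_l ?(ltW t0) // mulrAC; exact: step.
have [x xP] := choice (fun t => geometric_limit (c0 t) (stepc t)).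
have xX0 t : t <= 0 -> x t = xi.
  move=> t0; apply/eqP; rewrite eq_sym -subr_eq0 -normr_le0; apply/ler_addgt0Pr => e e0.
  have [k kP] := expr_half_lt (2 * c t) e0.
  by have := xP t k; rewrite X0 // add0r => /le_trans; apply.
have cmono s t : s <= t -> c s <= c t.
  move=> st; apply: ler_wpM2l => //; rewrite ler_expR; apply: ler_wpM2l.
    by rewrite mulr_ge0 // /L'; lra.
  by rewrite ge_max !le_max st lexx orbT.
have cx : continuous x.
  move=> t; apply/continuous_atP => e e0.
  have e30 : 0 < e / 3 by lra.
  have [k kP] := expr_half_lt (2 * c (t + 1)) e30.
  have [r r0 rP] := (continuous_atP _ _).1 (cX k t) _ e30.
  exists (Num.min r 1); first by rewrite lt_min r0 ltr01.
  move=> s; rewrite lt_min => /andP[sr]; rewrite ltr_norml => /andP[_ s1].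
  have near_X s' : s' <= t + 1 -> `|X k s' - x s'| <= e / 3.
    move=> s't; apply: le_trans (xP s' k) _; apply: le_trans kP.
    by apply: ler_wpM2r => //; apply: ler_wpM2l => //; exact: cmono.
  have := near_X s ltac:(by lra); have := near_X t ltac:(by lra).
  have := rP s sr.
  have -> : x s - x t = (X k s - X k t) + (- (X k s - x s) + (X k t - x t)).
    by apply/rowP => j; rewrite !mxE; ring.
  move=> h1 h2 h3; apply: le_trans (ler_normD _ _) _.
  by have := ler_normD (- (X k s - x s)) (X k t - x t); rewrite normrN; lra.
have [cI I0 dI] := IP _ (cFx _ cx).
(* The limit is a fixed point: [growth] compares its Picard image with [X k.+1], which is itself
   close to [x], both errors being multiples of [2^-1 ^+ k]. *)
have xE t : x t = xi + I (fun s => F (x s) s) t.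
  have [t0|t0] := lerP t 0; first by rewrite I0 // addr0 xX0.
  apply/eqP; rewrite -subr_eq0 -normr_le0; apply/ler_addgt0Pr => e e0.
  have [k kP] := expr_half_lt (4 * c t) e0.
  have h1 : `|X k.+1 t - (xi + I (fun s => F (x s) s) t)| <=
      2 * (M * 2^-1 ^+ k) * E t.
    apply: (growth (2 * (M * 2^-1 ^+ k)) t t0 _ (X k.+1)
      (fun t => xi + I (fun s => F (x s) s) t) (fun s => F (X k s) s)
      (fun s => F (x s) s)).
    - by rewrite !mulr_ge0.
    - exact: cX.
    - by move=> s; apply: cvgD; [exact: cvg_cst | exact: cI].
    - by rewrite X0 // I0 // addr0.
    - by move=> s s0; exact: dX.
    - move=> s s0; rewrite -[F _ _]add0r; apply: (@has_derivD R 'rV[R]_m (fun=> xi)).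
        exact: has_deriv_cst.
      exact: dI.
    - move=> s s0; apply: le_trans (FL _ _ _) _.
      apply: le_trans (_ : L' * (2 * c s * 2^-1 ^+ k) <= _).
        by apply: ler_pM => //; rewrite /L'; lra.
      rewrite /c max_l ?(ltW s0) //.
      have : 0 <= L' * (M * E s * 2^-1 ^+ k).
        by rewrite !mulr_ge0 // ?(ltW (E0 s)) // /L'; lra.
      lra.
  have h2 := xP t k.+1.
  have -> : x t - (xi + I (fun s => F (x s) s) t) =
      (X k.+1 t - (xi + I (fun s => F (x s) s) t)) - (X k.+1 t - x t).
    by rewrite opprB [RHS]addrC addrA subrK.
  apply: le_trans (ler_normB _ _) _; rewrite add0r; apply: le_trans kP.
  move: h2; rewrite /c max_l ?(ltW t0) // exprS.
  have := mulr_ge0 (mulr_ge0 M0 (half k)) (ltW (E0 t)).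
  lra.
exists x; split=> // t t0.
rewrite -[F _ _]add0r.
have : has_deriv (fun t => xi + I (fun s => F (x s) s) t) t (0 + F (x t) t).
  apply: (@has_derivD R 'rV[R]_m (fun=> xi)); last exact: dI.
  exact: has_deriv_cst.
by apply: (@has_deriv_near _ _ _ _ _ _ 1) => // s _; rewrite -xE.
Qed.

(** * Invariant sets and Lipschitz extension *)

Lemma nbhs_norm_lt (R : realType) (V : normedModType R) (x : V) (r : R) :
  0 < r -> nbhs x [set y | `|y - x| < r].
Proof. by move=> r0; apply/nbhs_normP; exists r => // y /=; rewrite distrC. Qed.

Lemma closure_normP (R : realType) (V : normedModType R) (A : set V) x :
  closure A x <-> forall e, 0 < e -> exists2 y, A y & `|y - x| < e.
Proof.
split=> [cl e e0|H B /nbhs_normP[e /= e0 eB]].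
  have /cl[y [Ay]] := nbhsx_ballx x e e0.
  by rewrite -ball_normE /= distrC; exists y.
have [y Ay yx] := H e e0; exists y; split=> //.
by apply: eB; rewrite /= distrC.
Qed.

Lemma within_continuousP (R : realType) (V W : normedModType R) (D : set V)
    (f : V -> W) :
  {within D, continuous f} <->
  forall x, D x -> forall e, 0 < e -> exists2 r, 0 < r &
    forall y, D y -> `|y - x| < r -> `|f y - f x| <= e.
Proof.
split=> [/subspace_continuousP H x Dx e e0|H].
  have /cvgrPdist_le /(_ e e0) /nbhs_normP[r /= r0 rP] := H x Dx.
  exists r => // y Dy yx; rewrite distrC; apply: rP => //=.
  by rewrite distrC.
apply/subspace_continuousP => x Dx; apply/cvgrPdist_le => e e0.
have [r r0 rP] := H x Dx e e0; apply/nbhs_normP; exists r => // y /= yx Dy.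
by rewrite distrC; apply: rP => //; rewrite distrC.
Qed.

Lemma compact_unif_continuous (R : realType) (V W : normedModType R) (D : set V)
    (f : V -> W) : compact D -> {within D, continuous f} ->
  forall e, 0 < e -> exists2 r, 0 < r &
    forall a b, D a -> D b -> `|a - b| < r -> `|f a - f b| <= e.
Proof.
move=> /compact_near_coveringP/near_covering_withinP cD.
move=> /within_continuousP cf e e0.
pose P (r : R) a := forall b, D b -> `|a - b| < r -> `|f a - f b| <= e.
have : \forall r \near (0 : R)^'+, D `<=` P r.
  apply: cD => x Dx.
  have e20 : 0 < e / 2 by lra.
  have [r r0 rP] := cf x Dx _ e20.
  have r20 : 0 < r / 2 by lra.
  exists ([set y | `|y - x| < r / 2], [set s | s < r / 2]) => /=.
    by split; [exact: nbhs_norm_lt | exact: nbhs_right_lt].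
  move=> [a s] /= [ax sr] Da b Db ab.
  have bx : `|b - x| < r.
    have -> : b - x = (b - a) + (a - x) by rewrite addrA subrK.
    by apply: le_lt_trans (ler_normD _ _) _; rewrite [`|b - a|]distrC; lra.
  have -> : f a - f b = (f a - f x) - (f b - f x) by rewrite opprB addrA subrK.
  apply: le_trans (ler_normB _ _) _.
  by have := rP a Da ltac:(by lra); have := rP b Db bx; lra.
move=> /(filterI (nbhs_right_gt (0 : R))) /filter_ex[r [r0 rP]].
by exists r => // a b Da Db; exact: rP.
Qed.

Lemma compact_norm_bounded (R : realType) (V W : normedModType R) (D : set V)
    (f : V -> W) : compact D -> {within D, continuous f} ->
  exists2 M, 0 <= M & forall x, D x -> `|f x| <= M.
Proof.
move=> cD cf; have [N [_ NP]] := compact_bounded (continuous_compact cf cD).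
exists (`|N| + 1) => [|x Dx]; first by have := normr_ge0 N; lra.
by apply: (NP (`|N| + 1)); [have := ler_norm N; lra | exists x].
Qed.

(** Both signs of [h] are included, since invariance is needed backward in time as well. The witness
    [z] stands in for the distance to [S]. *)
Definition tangent_at (R : realType) (V : normedModType R) (S : set V)
    (y w : V) : Prop :=
  forall e, 0 < e -> exists2 r, 0 < r &
    forall h, `|h| < r -> exists2 z, S z & `|y + h *: w - z| <= e * `|h|.

Lemma tangent_atN (R : realType) (V : normedModType R) (S : set V) (y w : V) :
  tangent_at S y w -> tangent_at S y (- w).
Proof.
move=> H e /H[r r0 rP]; exists r => // h hr.
have [|z Sz] := rP (- h); first by rewrite normrN.
by rewrite normrN scaleNr -scalerN; exists z.
Qed.

(* Nagumo: the distance f to S satisfies D^+ f <= L f, because the point of S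
   nearest to the curve can itself be moved with velocity V up to o(h). *)
Lemma nagumo (R : realType) (m : nat) (S : set 'rV[R]_m)
    (V : 'rV[R]_m -> R -> 'rV[R]_m) (x : R -> 'rV[R]_m) (L a b : R) :
  compact S -> 0 <= L -> (forall p q t, `|V p t - V q t| <= L * `|p - q|) ->
  (forall t y, a < t < b -> S y -> tangent_at S y (V y t)) ->
  continuous x -> (forall t, a < t < b -> has_deriv x t (V (x t) t)) ->
  S (x a) -> forall t, a <= t <= b -> S (x t).
Proof.
move=> cS L0 VL tanS cx dx Sa.
have nearest p : exists y, S y /\ forall z, S z -> `|p - y| <= `|p - z|.
  have S0 : S !=set0 by exists (x a).
  have [|y Sy yP] := @EVT_min_rV R m (fun y => `|p - y|) S S0 cS.
    apply/within_continuousP => y Sy e e0; exists e => // z Sz zy.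
    apply: le_trans (ler_dist_dist _ _) _.
    by rewrite opprB addrC addrA subrK distrC ltW.
  exists y; split; first by rewrite inE in Sy.
  by move=> z Sz; apply: yP; rewrite inE.
have [pi piP] := choice nearest.
have Spi p : S (pi p) by have [] := piP p.
have pimin p z : S z -> `|p - pi p| <= `|p - z| by have [_] := piP p; apply.
pose f t := `|x t - pi (x t)|.
have lipf s t : f s - f t <= `|x s - x t|.
  rewrite lerBlDr; apply: le_trans (pimin _ _ (Spi (x t))) _.
  by have -> : x s - pi (x t) = (x s - x t) + (x t - pi (x t));
    [rewrite addrA subrK | exact: ler_normD].
have cf : continuous f.
  move=> t; apply/continuous_atP => e e0.
  have [r r0 rP] := (continuous_atP _ _).1 (cx t) _ e0.
  exists r => // s /rP sx; rewrite ler_norml.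
  by have := lipf s t; have := lipf t s; rewrite distrC; lra.
move=> t tab.
have := @gronwall R f a b L 0 cf (fun=> normr_ge0 _) L0 (lexx _) _ t tab.
have fa : f a = 0.
  by apply/eqP; rewrite -normr_le0 normr_id; have := pimin (x a) _ Sa; rewrite subrr normr0.
rewrite fa add0r mul0r normr_le0 subr_eq0 => H.
suff /eqP -> : x t == pi (x t) by [].
apply: H => s e sab e0.
have e20 : 0 < e / 2 by lra.
have [r r0 rP] := tanS s (pi (x s)) sab (Spi _) _ e20.
have [q q0 qP] := dx s sab _ e20.
exists (Num.min r q); first by rewrite lt_min r0.
move=> h /andP[h0]; rewrite lt_min => /andP[hr hq].
have := rP h; have := qP h; rewrite gtr0_norm // => /(_ hq) h1 /(_ hr) [z Sz h2].
apply: le_trans (pimin _ _ Sz) _.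
(* Three contributions: the remainder of the curve, the remainder of tangency at the nearest point,
   and the old distance changed by the difference of the two velocities, which is at most
   [L * f s]. *)
have -> : x (s + h) - z = (x (s + h) - x s - h *: V (x s) s) +
    ((pi (x s) + h *: V (pi (x s)) s - z) +
     ((x s - pi (x s)) + h *: (V (x s) s - V (pi (x s)) s))).
  move: (x s) (pi (x s)) (V (pi (x s)) s) (V (x s) s) (x (s + h)) => p1 p2 p3 p4 p5.
  by apply/rowP => j; rewrite !mxE; ring.
apply: le_trans (ler_normD _ _) _.
apply: le_trans (lerD h1 (ler_normD _ _)) _.
apply: le_trans (lerD (lexx _) (lerD h2 (ler_normD _ _))) _.
rewrite normrZ gtr0_norm //.
have := ler_wpM2l (ltW h0) (VL (x s) (pi (x s)) s).
rewrite -/(f s); lra.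
Qed.

Lemma nagumo_backward (R : realType) (m : nat) (S : set 'rV[R]_m)
    (V : 'rV[R]_m -> R -> 'rV[R]_m) (x : R -> 'rV[R]_m) (L a b : R) :
  compact S -> 0 <= L -> (forall p q t, `|V p t - V q t| <= L * `|p - q|) ->
  (forall t y, a < t < b -> S y -> tangent_at S y (V y t)) ->
  continuous x -> (forall t, a < t < b -> has_deriv x t (V (x t) t)) ->
  S (x b) -> forall t, a <= t <= b -> S (x t).
Proof.
move=> cS L0 VL tanS cx dx Sb t tab.
have -> : t = b - (b - t) by rewrite opprB addrC subrK.
apply: (@nagumo R m S (fun y s => - V y (b - s)) (fun s => x (b - s)) L 0 (b - a)
  cS L0 _ _ _ _ _ (b - t)).
- by move=> p q s; rewrite -opprD normrN.
- by move=> s y sab Sy; apply: tangent_atN; apply: tanS => //; lra.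
- move=> s; apply: (@continuous_comp _ _ _ (fun s => b - s)); last exact: cx.
  by apply: cvgB; [exact: cvg_cst | exact: cvg_id].
- by move=> s sab; apply: has_deriv_reverse; apply: dx; lra.
- by rewrite subr0.
- lra.
Qed.

Section invariance.
Variables (R : realType) (m : nat) (Omega : set 'rV[R]_m)
  (V : 'rV[R]_m -> R -> 'rV[R]_m) (x : R -> 'rV[R]_m) (L a b : R).
Hypotheses (oO : open Omega) (cK : compact (boundary Omega)) (L0 : 0 <= L)
  (VL : forall p q t, `|V p t - V q t| <= L * `|p - q|)
  (tanV : forall t y, a < t < b -> boundary Omega y ->
    tangent_at (boundary Omega) y (V y t))
  (cx : continuous x)
  (dx : forall t, a < t < b -> has_deriv x t (V (x t) t)).

(** A first exit point would lie on the boundary; invariance of the boundary backward in time would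
    then put [x a] on it too. *)
Lemma stay_open : Omega (x a) -> forall t, a <= t <= b -> Omega (x t).
Proof.
move=> Oa; apply: real_induction => // c cab H.
- apply: contrapT => nO.
  have bc : boundary Omega (x c).
    split; last by rewrite (interior_id _).1.
    apply/closure_normP => e e0.
    have e20 : 0 < e / 2 by lra.
    have [r r0 rP] := (continuous_atP _ _).1 (@cx c) _ e20.
    pose d := Num.min (r / 2) (c - a).
    have d0 : 0 < d by rewrite lt_min; apply/andP; split; lra.
    have dr : d <= r / 2 by rewrite ge_min lexx.
    have da : d <= c - a by rewrite ge_min lexx orbT.
    exists (x (c - d)); first by apply: H; lra.
    apply: le_lt_trans (rP _ _) _; last by lra.
    by rewrite addrAC subrr sub0r normrN gtr0_norm //; lra.
  have [] := @nagumo_backward R m _ V x L a c cK L0 VL _ cx _ bc a ltac:(by lra).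
  + by move=> t y tac By; apply: tanV => //; lra.
  + by move=> t tac; apply: dx; lra.
  by rewrite (interior_id _).1.
- have : nbhs (x c) Omega by apply: open_nbhs_nbhs; split=> //; apply: H; lra.
  move=> /cx /nbhs_normP[r /= r0 rP]; exists r => // s sc.
  by apply: rP; rewrite /= distrC gtr0_norm; lra.
Qed.

Lemma stay_closure : closure Omega (x a) ->
  forall t, a <= t <= b -> closure Omega (x t).
Proof.
move=> ca t tab; have [Oa|nO] := pselect (Omega (x a)).
  by apply: subset_closure; exact: stay_open.
have ba : boundary Omega (x a) by split=> //; rewrite (interior_id _).1.
by have [] := nagumo cK L0 VL tanV cx dx ba tab.
Qed.

End invariance.

Lemma inf_image_close (R : realType) (T : Type) (K : set T) (f g : T -> R)
    (M e : R) : K !=set0 -> (forall y, K y -> - M <= f y) ->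
  (forall y, K y -> `|f y - g y| <= e) ->
  inf [set f y | y in K] - e <= inf [set g y | y in K].
Proof.
move=> [y0 Ky0] fM fg; apply: lb_le_inf; first by exists (g y0), y0.
move=> _ [y Ky <-].
have : inf [set f y | y in K] <= f y.
  by apply: ge_inf; [exists (- M) => _ [z Kz <-]; exact: fM | exists y].
by have := fg y Ky; rewrite ler_norml; lra.
Qed.

(* McShane's extension f_i(x) = inf_y (f_i(y) + C |x - y|) of each coordinate. *)
Lemma lipschitz_extension (R : realType) (m k : nat) (K : set 'rV[R]_m)
    (f : 'rV[R]_m -> R -> 'rV[R]_k) (C M : R) :
  K !=set0 -> 0 <= C ->
  (forall t a b, K a -> K b -> `|f a t - f b t| <= C * `|a - b|) ->
  (forall e, 0 < e -> exists2 r, 0 < r &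
    forall s t, `|s - t| < r -> forall y, K y -> `|f y s - f y t| <= e) ->
  (forall t y, K y -> `|f y t| <= M) ->
  exists V : 'rV[R]_m -> R -> 'rV[R]_k,
    [/\ forall t y, K y -> V y t = f y t,
        forall p q t, `|V p t - V q t| <= C * `|p - q|,
        forall x, continuous (V x) &
        forall x, exists B, forall t, `|V x t| <= B].
Proof.
move=> K0 C0 fC fU fM.
pose g x t i y := f y t 0 i + C * `|x - y|.
pose V x t := \row_i inf [set g x t i y | y in K].
have gM x t i y : K y -> - M <= g x t i y.
  move=> Ky; have := le_trans (ler_norm_coord (f y t) i) (fM t y Ky).
  by rewrite ler_norml /g; have := mulr_ge0 C0 (normr_ge0 (x - y)); lra.
(* Infima of uniformly close families are close. Both the Lipschitz bound in space and the
   continuity in time are instances. *)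
have close x t x' t' i e : (forall y, K y -> `|g x t i y - g x' t' i y| <= e) ->
    `|V x t 0 i - V x' t' 0 i| <= e.
  move=> H; rewrite ler_norml !mxE.
  have := @inf_image_close R _ K (g x t i) (g x' t' i) M e K0 (gM x t i) H.
  have H' y : K y -> `|g x' t' i y - g x t i y| <= e by rewrite distrC; exact: H.
  have := @inf_image_close R _ K (g x' t' i) (g x t i) M e K0 (gM x' t' i) H'.
  lra.
have VC p q t : `|V p t - V q t| <= C * `|p - q|.
  apply: rV_norm_leP => [|i]; first by rewrite mulr_ge0.
  have := @close p t q t i (C * `|p - q|); rewrite !mxE; apply => y Ky.
  rewrite /g (addrC (f y t 0 i)) addrKA -mulrBr normrM ger0_norm //.
  apply: ler_wpM2l => //; apply: le_trans (ler_dist_dist _ _) _.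
  by rewrite opprB addrA subrK.
have VE t y : K y -> V y t = f y t.
  move=> Ky; apply/rowP => i; rewrite !mxE; apply/eqP; rewrite eq_le; apply/andP; split.
    apply: ge_inf; first by exists (- M) => _ [z Kz <-]; exact: gM.
    by exists y => //; rewrite /g subrr normr0 mulr0 addr0.
  apply: lb_le_inf; first by exists (g y t i y), y.
  move=> _ [z Kz <-]; rewrite /g.
  have := le_trans (ler_norm_coord (f y t - f z t) i) (fC t y z Ky Kz).
  by rewrite !mxE ler_norml; lra.
exists V; split=> // [x t|x].
- apply/continuous_atP => e e0; have [r r0 rP] := fU e e0.
  exists r => // s sr; apply: rV_norm_leP => [|i]; first exact: ltW.
  have := @close x s x t i e; rewrite !mxE; apply => y Ky.
  rewrite /g (addrC (f y t 0 i)) addrKA.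
  by have := le_trans (ler_norm_coord (f y s - f y t) i) (rP s t sr y Ky); rewrite !mxE.
- have [y Ky] := K0; exists (M + C * `|x - y|) => t.
  have -> : V x t = f y t + (V x t - f y t) by rewrite addrC subrK.
  apply: le_trans (ler_normD _ _) _; apply: lerD; first exact: fM.
  by rewrite -(VE t _ Ky); exact: VC.
Qed.

(** * Coverings of lines *)

(** Integrate the hypothesis over [[a - rho, a + rho]] and exchange integral and series: an interval
    contributes its weight times at most its length [2 * r i]. *)
Lemma interval_cover_sum (R : realType) (b c r : nat -> R) (a rho k : R) :
  0 < rho -> (forall i, 0 <= b i) -> (forall i, 0 <= r i) -> 0 <= k ->
  (forall x, `|x - a| <= rho ->
    (k%:E <= \sum_(i <oo) (b i * (`|x - c i| <= r i)%R%:R)%R%:E)%E) ->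
  ((k * (2 * rho))%:E <= \sum_(i <oo) (b i * (2 * r i))%:E)%E.
Proof.
move=> rho0 b0 r0 k0 H.
pose mu := @lebesgue_measure R.
pose D := `[a - rho, a + rho]%classic.
have mD : measurable D by exact: measurable_itv.
have itvE c' r' : 0 <= r' -> mu `[c' - r', c' + r']%classic = (2 * r')%:E.
  move=> r'0; rewrite /mu lebesgue_measure_itv /= lte_fin.
  case: ifPn => [_|h]; first by rewrite -EFinB; congr EFin; lra.
  by congr EFin; rewrite -leNgt in h; lra.
have indE i x : (`|x - c i| <= r i)%R%:R = \1_(`[c i - r i, c i + r i]%classic) x :> R.
  rewrite indicE; congr (nat_of_bool _)%:R; apply/idP/idP.
    by rewrite ler_norml => h; apply/mem_set; rewrite /= in_itv /=; lra.
  by move=> /set_mem /=; rewrite in_itv /= ler_norml; lra.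
pose f i x := (b i * (`|x - c i| <= r i)%R%:R)%:E : \bar R.
have f0 i x : (0 <= f i x)%E by rewrite lee_fin mulr_ge0.
have fE i x : f i x = ((b i)%:E * (\1_(`[c i - r i, c i + r i]%classic) x)%:E)%E.
  by rewrite /f indE EFinM.
have mf i : measurable_fun D (f i).
  rewrite (_ : f i = fun x => (b i)%:E * (\1_(`[c i - r i, c i + r i]%classic) x)%:E)%E;
    last by apply/funext => x; exact: fE.
  apply: emeasurable_funM; first exact: measurable_cst.
  apply/measurable_EFinP; apply: measurable_indic; exact: measurable_itv.
have mS : measurable_fun D (fun x => \sum_(i <oo) f i x)%E.
  by apply: ge0_emeasurable_sum.
have S0 x : (0 <= \sum_(i <oo) f i x)%E by apply: nneseries_ge0.
apply: (@le_trans _ _ (\int[mu]_(x in D) (cst k%:E x))%E).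
  rewrite integral_cst // EFinM -(itvE a _ (ltW rho0)).
  exact: lexx.
apply: (@le_trans _ _ (\int[mu]_(x in D) (\sum_(i <oo) f i x))%E).
  apply: ge0_le_integral => //.
  move=> x; rewrite /D /= in_itv /= => xD; apply: H.
    by rewrite ler_norml; lra.
rewrite integral_nneseries //; apply: lee_nneseries => [i _ _|i _].
  by apply: integral_ge0.
under eq_integral do rewrite fE.
rewrite ge0_integralZl_EFin //; last first.
  apply/measurable_EFinP; apply: measurable_indic; exact: measurable_itv.
rewrite integral_indic //= EFinM; apply: lee_wpmul2l; first by rewrite lee_fin.
rewrite -(itvE (c i)) //; apply: le_measure; rewrite ?inE.
- by apply: measurableI => //; exact: measurable_itv.
- exact: measurable_itv.
- exact: subIsetl.
Qed.

(** Fubini for boxes, by induction: integrating out coordinate [m] moves the interval length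
    [2 * r i] into the weight and [2 * rho] into [k]. Points are sequences, so that one coordinate
    can be replaced without changing the index type. *)
Lemma box_cover_sum (R : realType) (m : nat) (w : nat -> R) (c : nat -> nat -> R)
    (r : nat -> R) (z0 : nat -> R) (rho k : R) :
  0 < rho -> (forall i, 0 <= w i) -> (forall i, 0 <= r i) -> 0 <= k ->
  (forall z, (forall j, `|z j - z0 j| <= rho) ->
    (k%:E <= \sum_(i <oo) (w i * \prod_(j < m) (`|z j - c i j| <= r i)%R%:R)%R%:E)%E) ->
  ((k * (2 * rho) ^+ m)%:E <= \sum_(i <oo) (w i * (2 * r i) ^+ m)%:E)%E.
Proof.
move=> rho0 + r0; elim: m w k => [|m IH] w k w0 k0 H.
  have := H z0 ltac:(by move=> j; rewrite subrr normr0 ltW).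
  rewrite expr0 mulr1; under eq_eseriesr do rewrite big_ord0 mulr1.
  by under [in X in _ -> X]eq_eseriesr do rewrite expr0 mulr1.
have -> : k * (2 * rho) ^+ m.+1 = (k * (2 * rho)) * (2 * rho) ^+ m.
  by rewrite exprS mulrA.
under eq_eseriesr do rewrite exprS mulrA.
apply: IH => [i||z zP]; first by rewrite !mulr_ge0.
  by rewrite !mulr_ge0 // ltW.
have := @interval_cover_sum R (fun i => w i * \prod_(j < m) (`|z j - c i j| <= r i)%R%:R)
  (fun i => c i m) r (z0 m) rho k rho0 _ r0 k0.
under [in X in _ -> X]eq_eseriesr do rewrite mulrAC.
apply; first by move=> i; rewrite mulr_ge0 // prodr_ge0.
move=> x xP.
have := H (fun j => if j == m then x else z j).
under eq_eseriesr.
  move=> i _; rewrite big_ord_recr /= eqxx mulrA.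
  rewrite (eq_bigr (fun j : 'I_m => (`|z j - c i j| <= r i)%R%:R)); last first.
    by move=> j _; rewrite (ltn_eqF (ltn_ord j)).
  over.
by apply => j; case: eqP => // ->.
Qed.

(* Integrates over the transversal variables z_1, ..., z_m the total length that
   the boxes cut off the line z + R d. *)
Lemma short_cover_line (R : realType) (m : nat) (z0 d : 'rV[R]_m.+1) (rho eta : R) :
  d 0 0 != 0 -> 0 < rho -> 0 < eta ->
  exists2 delta, 0 < delta &
    forall (c : nat -> 'rV[R]_m.+1) (r : nat -> R), (forall i, 0 <= r i) ->
    (\sum_(i <oo) (r i ^+ m.+1)%:E <= delta%:E)%E ->
    exists z (p l : nat -> R),
      [/\ `|z - z0| <= rho, forall i, 0 <= l i,
          (\sum_(i <oo) (l i)%:E <= eta%:E)%E &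
          forall i s, `|z + s *: d - c i| <= r i -> `|s - p i| <= l i].
Proof.
move=> d0 rho0 eta0.
have nd0 : 0 < `|d 0 0| by rewrite normr_gt0.
(* Projecting along [d] onto a hyperplane of constant coordinate 0 enlarges a cube at most by the
   factor [T]. *)
pose T := 1 + `|d| / `|d 0 0|.
have T0 : 0 < T by apply: ltr_pwDl => //; exact: divr_ge0.
pose C := (2 * T) ^+ m / `|d 0 0|.
have C0 : 0 < C by rewrite divr_gt0 // exprn_gt0 // mulr_gt0.
have A0 : 0 < eta * (2 * rho) ^+ m by rewrite mulr_gt0 // exprn_gt0 // mulr_gt0.
(* If every line had total length at least [eta], [box_cover_sum] would force the sum of the
   [r i ^+ m.+1] to be at least twice this value. *)
exists (eta * (2 * rho) ^+ m / C / 2).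
  by rewrite divr_gt0 // divr_gt0.
move=> c r r0 sumr.
(* [p i] is the parameter at which the line reaches coordinate 0 of [c i], [w i] the half-length of
   the passage through that slab, and [D i] the projection of [c i] along [d] to the height of [z0];
   its entry [k] belongs to coordinate [k.+1]. *)
pose p i := (c i 0 0 - z0 0 0) / d 0 0.
pose w i := r i / `|d 0 0|.
have w0 i : 0 <= w i by rewrite divr_ge0 // ltW.
pose D i (k : nat) := c i 0 (inord k.+1) - p i * d 0 (inord k.+1).
pose l z i := w i * \prod_(j < m) (`|z (nat_of_ord j) - D i j| <= T * r i)%R%:R.
have l0 z i : 0 <= l z i by rewrite mulr_ge0 // prodr_ge0.
pose zeta0 k := z0 0 (inord k.+1).
have [z [zP zsum]] : exists z : nat -> R, (forall j, `|z j - zeta0 j| <= rho) /\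
    (\sum_(i <oo) (l z i)%:E <= eta%:E)%E.
  apply: contrapT => nex.
  have := @box_cover_sum R m w D (fun i => T * r i) zeta0 rho eta rho0 w0
    (fun i => mulr_ge0 (ltW T0) (r0 i)) (ltW eta0).
  have H z : (forall j, `|z j - zeta0 j| <= rho) ->
      (eta%:E <= \sum_(i <oo) (l z i)%:E)%E.
    move=> zP; apply: ltW; rewrite ltNge; apply/negP => le.
    by apply: nex; exists z.
  move=> /(_ H).
  have E i : (w i * (2 * (T * r i)) ^+ m)%:E = (C%:E * (r i ^+ m.+1)%:E)%E.
    rewrite -EFinM; congr EFin; rewrite /w /C mulrA exprMn exprS.
    by move: ((2 * T) ^+ m) (r i ^+ m) (`|d 0 0|^-1) => x y q; ring.
  under eq_eseriesr do rewrite E.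
  rewrite nneseriesZl; last by move=> i _; rewrite lee_fin exprn_ge0.
  move=> le1; have := le_trans le1 (lee_wpmul2l _ sumr).
  rewrite lee_fin => /(_ (ltW C0)); rewrite -EFinM lee_fin.
  have -> : C * (eta * (2 * rho) ^+ m / C / 2) = eta * (2 * rho) ^+ m / 2.
    by rewrite mulrC mulrAC divfK ?gt_eqF.
  by lra.
pose Z : 'rV[R]_m.+1 := \row_k (if k == 0 then z0 0 0 else z k.-1).
have ordK (k : 'I_m.+1) : k != 0 -> inord k.-1.+1 = k.
  move=> k0; apply: val_inj; rewrite /= inordK prednK ?lt0n //.
exists Z, p, (l z); split=> //.
- apply: rV_norm_leP => [|k]; first exact: ltW.
  rewrite !mxE; case: eqVneq => [->|k0]; first by rewrite subrr normr0 ltW.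
  by have := zP k.-1; rewrite /zeta0 ordK.
move=> i s H.
have coord k := le_trans (ler_norm_coord _ k) H.
have sp : `|s - p i| <= w i.
  have := coord 0; rewrite !mxE eqxx => h.
  rewrite -(ler_pM2r nd0) /w divfK ?gt_eqF // -normrM.
  by have -> : (s - p i) * d 0 0 = z0 0 0 + s * d 0 0 - c i 0 0;
    [rewrite mulrBl /p divfK // opprB; ring | ].
rewrite /l big1 ?mulr1 // => j _.
suff -> : `|z j - D i j| <= T * r i by [].
have kE : inord j.+1 = lift ord0 j :> 'I_m.+1.
  by apply: val_inj; rewrite /= inordK // ltnS.
have := coord (lift ord0 j); rewrite !mxE /= => h.
rewrite /D kE.
have -> : z j - (c i 0 (lift ord0 j) - p i * d 0 (lift ord0 j)) =
    (z j + s * d 0 (lift ord0 j) - c i 0 (lift ord0 j)) -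
    (s - p i) * d 0 (lift ord0 j) by ring.
apply: le_trans (ler_normB _ _) _.
rewrite normrM.
have : `|s - p i| * `|d 0 (lift ord0 j)| <= w i * `|d|.
  by apply: ler_pM => //; exact: ler_norm_coord.
move=> h2; apply: le_trans (lerD h h2) _.
rewrite /w /T mulrDl mul1r lerD2l.
by have -> : r i / `|d 0 0| * `|d| = `|d| / `|d 0 0| * r i by ring.
Qed.

(** Real induction on the bound [e * (s - a) + K * S s], where [S s] is the measure of [O] in
    [[a, s]]: inside [O] this measure grows at unit rate and pays for the Lipschitz bound, elsewhere
    the slope [e] does. *)
Lemma increment_off_open (R : realType) (phi : R -> R) (O : set R)
    (a b K e eta : R) :
  0 <= K -> 0 <= e -> (forall s t, `|phi s - phi t| <= K * `|s - t|) ->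
  open O -> (lebesgue_measure O <= eta%:E)%E ->
  (forall s, a <= s < b -> O s \/ exists2 r, 0 < r &
    forall h, 0 < h < r -> `|phi (s + h) - phi s| <= e * h) ->
  a <= b -> `|phi b - phi a| <= e * (b - a) + K * eta.
Proof.
move=> K0 e0 phiK oO muO H ab.
pose mu := @lebesgue_measure R.
have mO : measurable O by exact: open_measurable.
pose A s := O `&` `[a, s]%classic.
have mA s : measurable (A s) by apply: measurableI => //; exact: measurable_itv.
have Aeta s : (mu (A s) <= eta%:E)%E.
  apply: le_trans muO; apply: le_measure; last exact: subIsetl.
    exact: mem_set (mA s).
  exact: mem_set mO.
have Afin s : mu (A s) \is a fin_num.
  by rewrite ge0_fin_numE //; apply: le_lt_trans (Aeta s) (ltry _).
pose S s := fine (mu (A s)).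
have Smono s t : s <= t -> S s <= S t.
  move=> st; apply: fine_le => //; apply: le_measure.
  - exact: mem_set (mA s).
  - exact: mem_set (mA t).
  move=> x [Ox]; rewrite /= !in_itv /= => xs; split=> //=.
  by rewrite in_itv /=; lra.
have Sadd s h : a <= s -> 0 < h -> (forall x, s < x < s + h -> O x) ->
    S s + h <= S (s + h).
  move=> as_ h0 sub.
  pose B := `]s, s + h[%classic.
  have mB : measurable B by exact: measurable_itv.
  have muB : mu B = h%:E.
    rewrite /mu /B lebesgue_measure_itv /= lte_fin ltrDl h0 -EFinB; congr EFin; ring.
  have <- : fine (mu (A s `|` B)) = S s + h.
    have -> : mu (A s `|` B) = (mu (A s) + mu B)%E.
      rewrite /mu measureU //; first exact: mA.
      by apply/seteqP; split=> // x [[_]]; rewrite /B /= !in_itv /= => h1 h2; lra.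
    by rewrite muB fineD.
  have sub' : A s `|` B `<=` A (s + h).
    move=> x [[Ox]|]; rewrite /B /= !in_itv /= => hx.
      by split=> //=; rewrite in_itv /=; lra.
    by split=> /=; [apply: sub | rewrite in_itv /=; lra].
  have mU := measurableU _ _ (mA s) mB.
  have le1 : (mu (A s `|` B) <= mu (A (s + h)%R))%E.
    by apply: le_measure => //; [exact: mem_set mU|exact: mem_set (mA _)].
  apply: fine_le => //; rewrite ge0_fin_numE //.
  by apply: le_lt_trans le1 _; apply: le_lt_trans (Aeta _) (ltry _).
have main : forall s, a <= s <= b -> `|phi s - phi a| <= e * (s - a) + K * S s.
  apply: real_induction => [|c cab below|c cab upto].
  - rewrite !subrr normr0 mulr0 add0r mulr_ge0 // fine_ge0 //.
  - apply/ler_addgt0Pr => d d0.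
    pose h := Num.min (c - a) (d / (K + 1)).
    have h0 : 0 < h by rewrite lt_min divr_gt0 ?andbT //; lra.
    have ha : h <= c - a by rewrite ge_min lexx.
    have hd : K * h <= d.
      apply: le_trans (_ : (K + 1) * (d / (K + 1)) <= _).
        by apply: ler_pM => //; [lra | lra | rewrite ge_min lexx orbT].
      by rewrite mulrC divfK // gt_eqF //; lra.
    have := below (c - h) ltac:(by lra).
    have ch : c - (c - h) = h by ring.
    have := phiK c (c - h); rewrite ch (gtr0_norm h0).
    have := ler_wpM2l K0 (Smono (c - h) c ltac:(by lra)).
    have := ler_wpM2l e0 (_ : c - h - a <= c - a).
    have -> : phi c - phi a = (phi c - phi (c - h)) + (phi (c - h) - phi a) by ring.
    have := ler_normD (phi c - phi (c - h)) (phi (c - h) - phi a).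
    move=> h1 h2 h3 h4 h5; have := h2 ltac:(by lra); lra.
  - have Pc := upto c ltac:(by lra).
    have split_phi s : `|phi s - phi a| <= `|phi s - phi c| + `|phi c - phi a|.
      have -> : phi s - phi a = (phi s - phi c) + (phi c - phi a) by ring.
      exact: ler_normD.
    have [Oc|[r r0 rP]] := H c cab.
      have /nbhs_normP[r /= r0 rP] : nbhs c O by apply: open_nbhs_nbhs.
      exists r => // s sc.
      have := Sadd c (s - c) ltac:(by lra) ltac:(by lra).
      rewrite (addrC c) subrK => Sad.
      have : S c + (s - c) <= S s.
        apply: Sad => x xs; apply: rP; rewrite /= distrC gtr0_norm; lra.
      move=> /(ler_wpM2l K0); rewrite mulrDr => h1.
      have := phiK s c; rewrite [`|s - c|]gtr0_norm; last by lra.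
      have := split_phi s.
      have := ler_wpM2l e0 (_ : c - a <= s - a).
      move=> h2 h3 h4; have := h2 ltac:(by lra); lra.
    exists r => // s sc.
    have := rP (s - c) ltac:(by lra); rewrite (addrC c) subrK.
    have := split_phi s; have := ler_wpM2l K0 (Smono c s ltac:(by lra)); lra.
apply: le_trans (main b ltac:(by lra)) _.
rewrite lerD2l; apply: ler_wpM2l => //.
by rewrite -lee_fin fineK.
Qed.

(** Outer regularity encloses the closed intervals in an open set of almost the same measure, which
    lets an induction step move to the right. The factor 2 appears because the [l i] are
    half-lengths. *)
Lemma increment_off_intervals (R : realType) (phi : R -> R) (p l : nat -> R)
    (a b K e eta : R) :
  0 <= K -> 0 <= e -> (forall s t, `|phi s - phi t| <= K * `|s - t|) ->
  (forall i, 0 <= l i) -> (\sum_(i <oo) (l i)%:E <= eta%:E)%E ->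
  (forall s, a <= s < b -> (exists i, `|s - p i| <= l i) \/ exists2 r, 0 < r &
    forall h, 0 < h < r -> `|phi (s + h) - phi s| <= e * h) ->
  a <= b -> `|phi b - phi a| <= e * (b - a) + K * (2 * eta).
Proof.
move=> K0 e0 phiK l0 suml H ab; apply/ler_addgt0Pr => d d0.
pose mu := @lebesgue_measure R.
pose I i := `[p i - l i, p i + l i]%classic.
pose J := \bigcup_i I i.
have mJ : measurable J by apply: bigcup_measurable => i _; exact: measurable_itv.
have muJ : (mu J <= (2 * eta)%:E)%E.
  apply: (@le_trans _ _ (\sum_(i <oo) mu (I i))%E).
    by apply: measure_sigma_subadditive => // i; exact: measurable_itv.
  rewrite EFinM; apply: le_trans (lee_wpmul2l _ suml); last by rewrite lee_fin.
  rewrite -nneseriesZl; last by move=> i _; rewrite lee_fin.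
  apply: lee_nneseries => // i _; rewrite /mu lebesgue_measure_itv /= lte_fin.
  case: ifPn => _; last by rewrite lee_fin mulr_ge0.
  by rewrite -EFinB -EFinM lee_fin; lra.
have d'0 : 0 < d / (K + 1) by apply: divr_gt0 => //; lra.
have [U [oU JU muU]] :=
  lebesgue_regularity_outer mJ (le_lt_trans muJ (ltry _)) d'0.
have muU' : (mu U <= (2 * eta + d / (K + 1))%:E)%E.
  have mU : measurable U by exact: open_measurable.
  rewrite -(setDUK JU) EFinD.
  apply: le_trans (measureU2 _ _ _) _ => //; first exact: measurableD.
  by apply: leeD => //; exact: ltW.
apply: le_trans (increment_off_open K0 e0 phiK oU muU' _ ab) _.
  move=> s /H[[i si]|]; last by right.
  left; apply: JU; exists i => //; rewrite /I /= in_itv /=.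
  by move: si; rewrite ler_norml; lra.
rewrite -addrA lerD2l (mulrDr K) lerD2l.
apply: le_trans (_ : (K + 1) * (d / (K + 1)) <= _).
  by apply: ler_wpM2r; [exact: ltW | lra].
by rewrite mulrC divfK // gt_eqF //; lra.
Qed.

(** * Graph charts *)

Lemma ballE_norm (R : realType) (V : normedModType R) (p x : V) (r : R) :
  ball p r x <-> `|x - p| < r.
Proof. by rewrite -ball_normE /= distrC. Qed.

Lemma mulmx_norm_bound (R : realType) (m k : nat) (M : 'M[R]_(m, k)) :
  exists2 C, 1 <= C & forall x : 'rV[R]_m, `|x *m M| <= C * `|x|.
Proof.
have S0 : 0 <= \sum_i \sum_j `|M i j| by apply: sumr_ge0 => i _; apply: sumr_ge0.
exists (1 + \sum_i \sum_j `|M i j|) => [|x]; first by lra.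
apply: rV_norm_leP => [|j]; first by rewrite mulr_ge0 //; lra.
rewrite mxE; apply: le_trans (ler_norm_sum _ _ _) _.
apply: le_trans (_ : (\sum_i \sum_j `|M i j|) * `|x| <= _); last first.
  by apply: ler_wpM2r => //; lra.
rewrite mulr_suml; apply: ler_sum => i _; rewrite normrM mulrC.
apply: ler_pM => //; last exact: ler_norm_coord.
by rewrite (bigD1 j) //= lerDl; apply: sumr_ge0.
Qed.

Lemma lipschitzP (R : realType) (V W : normedModType R) (g : V -> W) :
  lipschitz g -> exists2 L, 0 <= L & forall a b, `|g a - g b| <= L * `|a - b|.
Proof.
move=> [N [_ NP]]; exists (`|N| + 1) => [|a b]; first by have := normr_ge0 N; lra.
by apply: (NP (`|N| + 1) _ (a, b)) => //; have := ler_norm N; lra.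
Qed.

Section chart_coordinates.
Variables (R : realType) (n : nat) (Q : 'M[R]_(1 + n)).

Definition chart_head (x : 'rV[R]_n.+1) : R := (x *m Q) 0 0.
Definition chart_tail (x : 'rV[R]_n.+1) : 'rV[R]_n :=
  rsubmx (x *m Q : 'rV[R]_(1 + n)).
Definition chart_point (a : R) (z : 'rV[R]_n) : 'rV[R]_n.+1 :=
  row_mx a%:M z *m Q^T.

Lemma chart_headB x y : chart_head (x - y) = chart_head x - chart_head y.
Proof. by rewrite /chart_head mulmxBl !mxE. Qed.

Lemma chart_headD x y : chart_head (x + y) = chart_head x + chart_head y.
Proof. by rewrite /chart_head mulmxDl !mxE. Qed.

Lemma chart_headZ k x : chart_head (k *: x) = k * chart_head x.
Proof. by rewrite /chart_head -scalemxAl !mxE. Qed.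

Lemma chart_tailB x y : chart_tail (x - y) = chart_tail x - chart_tail y.
Proof. by rewrite /chart_tail mulmxBl; apply/rowP => i; rewrite !mxE. Qed.

Lemma chart_tailD x y : chart_tail (x + y) = chart_tail x + chart_tail y.
Proof. by rewrite /chart_tail mulmxDl; apply/rowP => i; rewrite !mxE. Qed.

Lemma chart_tailZ k x : chart_tail (k *: x) = k *: chart_tail x.
Proof. by rewrite /chart_tail -scalemxAl; apply/rowP => i; rewrite !mxE. Qed.

Lemma chart_pointB a b z w :
  chart_point a z - chart_point b w = chart_point (a - b) (z - w).
Proof.
rewrite /chart_point -mulmxBl; congr (_ *m _).
by rewrite opp_row_mx add_row_mx -raddfB.
Qed.

(** The sup norm is not invariant under the rotation [Q], so each passage to or from chart
    coordinates costs a factor. *)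
Lemma chart_norm_bound : exists2 C, 1 <= C &
  [/\ forall x, `|chart_head x| <= C * `|x|,
      forall x, `|chart_tail x| <= C * `|x| &
      forall a z, `|chart_point a z| <= C * (`|a| + `|z|)].
Proof.
have [C C1 CP] := mulmx_norm_bound Q.
have [D D1 DP] := mulmx_norm_bound Q^T.
exists (Num.max C D); first by rewrite le_max C1.
have CM (x : 'rV[R]_n.+1) : `|x *m Q| <= Num.max C D * `|x|.
  by apply: le_trans (CP x) _; apply: ler_wpM2r => //; rewrite le_max lexx.
split=> [x|x|a z].
- by apply: le_trans (CM x); exact: ler_norm_coord.
- apply: le_trans (CM x); apply: rV_norm_leP => // i.
  by rewrite mxE; exact: ler_norm_coord.
- apply: le_trans (DP _) _.
  apply: ler_pM => //; [lra | by rewrite le_max lexx orbT |].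
  apply: rV_norm_leP => [|i]; first by rewrite addr_ge0.
  rewrite mxE; case: splitP => j _.
    rewrite mxE ord1 eqxx mulr1n; have := normr_ge0 z; lra.
  by have := ler_norm_coord z j; have := normr_ge0 a; lra.
Qed.

Hypothesis QQt : Q *m Q^T = 1%:M.

Lemma chart_head_point a z : chart_head (chart_point a z) = a.
Proof.
rewrite /chart_head /chart_point -mulmxA (mulmx1C QQt) mulmx1.
have -> : (0 : 'I_(1 + n)) = lshift n (0 : 'I_1) by apply: val_inj.
by rewrite row_mxEl mxE eqxx mulr1n.
Qed.

Lemma chart_tail_point a z : chart_tail (chart_point a z) = z.
Proof.
by rewrite /chart_tail /chart_point -mulmxA (mulmx1C QQt) mulmx1 row_mxKr.
Qed.

Lemma chart_pointK x : chart_point (chart_head x) (chart_tail x) = x.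
Proof.
rewrite /chart_point /chart_tail.
have -> : (chart_head x)%:M = lsubmx (x *m Q : 'rV[R]_(1 + n)).
  apply/matrixP => i j; rewrite !ord1 !mxE eqxx mulr1n /chart_head mxE.
  by apply: eq_bigr => k _; congr (_ * Q _ _); apply: val_inj.
by rewrite hsubmxK -mulmxA QQt mulmx1.
Qed.

End chart_coordinates.

Section graph_chart.
Variables (R : realType) (n : nat) (Omega : set 'rV[R]_n.+1) (p : 'rV[R]_n.+1)
  (r : R) (Q : 'M[R]_(1 + n)) (g : 'rV[R]_n -> R).
Hypotheses (oO : open Omega) (chart : lipschitz_graph_at Omega p r Q g).

Let hd := chart_head Q.
Let tl := chart_tail Q.
Let pt := chart_point Q.

Lemma chart_interior x : `|x - p| < r -> (Omega x <-> hd x < g (tl x)).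
Proof. by case: chart => _ _ _ H /ballE_norm /H. Qed.

(** Continuity of [g] excludes limits of points of [Omega] strictly above the graph, and openness of
    [Omega] excludes points strictly below it. Conversely, points straight below a graph point
    belong to [Omega] and approach it. *)
Lemma chart_boundary x : `|x - p| < r -> (boundary Omega x <-> hd x = g (tl x)).
Proof.
move=> xr; have [r0 QQt lipg _] := chart.
have [L L0 LP] := lipschitzP lipg.
have [C C1 [Chd Ctl Cpt]] := chart_norm_bound Q.
have C0 : 0 <= C by lra.
have inter : interior Omega = Omega by exact: (interior_id _).1.
split=> [[cl nO]|E].
- rewrite inter in nO.
  apply/eqP; rewrite eq_le; apply/andP; split; last first.
    by rewrite leNgt; apply/negP => lt; apply: nO; apply/chart_interior.
  apply/ler_addgt0Pr => e e0.
  have D0 : 0 < C * (1 + L) by apply: mulr_gt0; lra.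
  pose d := Num.min (r - `|x - p|) (e / (C * (1 + L))).
  have d0 : 0 < d by rewrite lt_min; apply/andP; split; [lra | exact: divr_gt0].
  have [y Oy yx] := (closure_normP _ _).1 cl d d0.
  have dr : d <= r - `|x - p| by rewrite ge_min lexx.
  have de : d <= e / (C * (1 + L)) by rewrite ge_min lexx orbT.
  have yr : `|y - p| < r.
    have -> : y - p = (y - x) + (x - p) by rewrite addrA subrK.
    by apply: le_lt_trans (ler_normD _ _) _; lra.
  have /(chart_interior yr) lt := Oy.
  have h1 := Chd (x - y); have h2 := LP (tl y) (tl x); have h3 := Ctl (y - x).
  rewrite chart_headB distrC -/hd in h1; rewrite chart_tailB -/tl in h3.
  rewrite distrC in h1.
  have h4 : `|g (tl y) - g (tl x)| <= L * (C * `|y - x|).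
    by apply: le_trans h2 _; apply: ler_wpM2l.
  have h5 : C * (1 + L) * `|y - x| <= e.
    apply: le_trans (_ : C * (1 + L) * (e / (C * (1 + L))) <= _).
      by apply: ler_wpM2l; [exact: ltW | lra].
    by rewrite mulrC divfK // gt_eqF.
  rewrite (distrC x y) in h1.
  move: h1 h4; rewrite !ler_norml; lra.
- split; last by rewrite inter => /(chart_interior xr); rewrite E ltxx.
  apply/closure_normP => e e0.
  pose d := Num.min e (r - `|x - p|) / (2 * C).
  have m0 : 0 < Num.min e (r - `|x - p|) by rewrite lt_min e0 subr_gt0.
  have C20 : 0 < 2 * C by lra.
  have d0 : 0 < d by exact: divr_gt0.
  have dE : 2 * C * d = Num.min e (r - `|x - p|) by rewrite mulrC divfK // gt_eqF.
  have me : Num.min e (r - `|x - p|) <= e by rewrite ge_min lexx.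
  have mr : Num.min e (r - `|x - p|) <= r - `|x - p| by rewrite ge_min lexx orbT.
  have yx : `|pt (hd x - d) (tl x) - x| <= C * d.
    rewrite -{3}(chart_pointK QQt x) chart_pointB subrr.
    have -> : hd x - d - chart_head Q x = - d by rewrite /hd; ring.
    by apply: le_trans (Cpt _ _) _; rewrite normrN normr0 addr0 gtr0_norm.
  have Cd0 : 0 < C * d by apply: mulr_gt0 => //; lra.
  exists (pt (hd x - d) (tl x)); last by lra.
  apply/chart_interior.
    have -> : pt (hd x - d) (tl x) - p = (pt (hd x - d) (tl x) - x) + (x - p).
      by rewrite addrA subrK.
    by apply: le_lt_trans (ler_normD _ _) _; lra.
  by rewrite /hd /tl chart_head_point // chart_tail_point // -/hd -/tl E; lra.
Qed.

(** As [g] is Lipschitz, distance to the graph and vertical distance are comparable. The bound on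
    [|h|] by [r] only keeps the nearby boundary points inside the chart. *)
Lemma tangent_graphP x w : `|x - p| < r -> boundary Omega x ->
  tangent_at (boundary Omega) x w <->
  forall e, 0 < e -> exists2 d, 0 < d & forall h, `|h| < d ->
    `|g (tl x + h *: tl w) - g (tl x) - h * hd w| <= e * `|h|.
Proof.
move=> xr bx; have [r0 QQt lipg _] := chart.
have [L L0 LP] := lipschitzP lipg.
have [C C1 [Chd Ctl Cpt]] := chart_norm_bound Q.
have C0 : 0 <= C by lra.
have xE := (chart_boundary xr).1 bx.
have near_x z h e : `|x + h *: w - z| <= e * `|h| -> 0 < e ->
    `|h| < (r - `|x - p|) / (`|w| + e) -> `|z - p| < r.
  move=> H e0; rewrite ltr_pdivlMr; last by have := normr_ge0 w; lra.
  move=> hr; have -> : z - p = (x - p) + (h *: w - (x + h *: w - z)).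
    by apply/rowP => i; rewrite !mxE; ring.
  apply: le_lt_trans (ler_normD _ _) _.
  by have := ler_normB (h *: w) (x + h *: w - z); rewrite normrZ; lra.
have rad0 e : 0 < e -> 0 < (r - `|x - p|) / (`|w| + e).
  by move=> e0; apply: divr_gt0; [lra | have := normr_ge0 w; lra].
split=> H e e0.
- have D0 : 0 < C * (1 + L) by apply: mulr_gt0; lra.
  have e'0 : 0 < e / (C * (1 + L)) by exact: divr_gt0.
  have [d d0 dP] := H _ e'0.
  exists (Num.min d ((r - `|x - p|) / (`|w| + e / (C * (1 + L))))).
    by rewrite lt_min d0 rad0.
  move=> h; rewrite lt_min => /andP[hd_ hr].
  have [z bz zP] := dP h hd_.
  have zr := near_x z h _ zP e'0 hr.
  have zE := (chart_boundary zr).1 bz.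
  have h1 := le_trans (Chd (x + h *: w - z)) (ler_wpM2l C0 zP).
  have h2 := le_trans (Ctl (x + h *: w - z)) (ler_wpM2l C0 zP).
  rewrite chart_headB chart_headD chart_headZ -/hd zE xE in h1.
  rewrite chart_tailB chart_tailD chart_tailZ -/tl in h2.
  have h3 := le_trans (LP (tl x + h *: tl w) (tl z)) (ler_wpM2l L0 h2).
  have -> : g (tl x + h *: tl w) - g (tl x) - h * hd w =
    (g (tl x + h *: tl w) - g (tl z)) - (g (tl x) + h * hd w - g (tl z)) by ring.
  apply: le_trans (ler_normB _ _) _.
  apply: le_trans (lerD h3 h1) _.
  have -> : L * (C * (e / (C * (1 + L)) * `|h|)) + C * (e / (C * (1 + L)) * `|h|) =
    e / (C * (1 + L)) * (C * (1 + L)) * `|h| by ring.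
  by rewrite divfK // gt_eqF.
- have e'0 : 0 < e / C by apply: divr_gt0 => //; lra.
  have [d d0 dP] := H _ e'0.
  exists (Num.min d ((r - `|x - p|) / (`|w| + e))); first by rewrite lt_min d0 rad0.
  move=> h; rewrite lt_min => /andP[hd_ hr].
  pose z := pt (g (tl x + h *: tl w)) (tl x + h *: tl w).
  have zP : `|x + h *: w - z| <= e * `|h|.
    rewrite -(chart_pointK QQt (x + h *: w)) chart_pointB.
    rewrite chart_headD chart_headZ chart_tailD chart_tailZ -/hd -/tl subrr xE.
    apply: le_trans (Cpt _ _) _; rewrite normr0 addr0 distrC.
    have -> : g (tl x + h *: tl w) - (g (tl x) + h * hd w) =
      g (tl x + h *: tl w) - g (tl x) - h * hd w by ring.
    apply: le_trans (ler_wpM2l C0 (dP h hd_)) _.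
    by rewrite mulrA [C * _]mulrC divfK // gt_eqF //; lra.
  exists z => //; apply/chart_boundary; first exact: near_x zP e0 hr.
  by rewrite /hd /tl /z chart_head_point // chart_tail_point.
Qed.

End graph_chart.

Lemma dotv_chart (R : realType) (n : nat) (Q : 'M[R]_(1 + n)) (w : 'rV[R]_n.+1)
    (c : R) (G : 'rV[R]_n) :
  dotv w (c *: (row_mx 1%:M (- G) *m Q^T)) =
  c * (chart_head Q w - \sum_i chart_tail Q w 0 i * G 0 i).
Proof.
have dotE (u q : 'rV[R]_n.+1) : dotv u q = (u *m q^T) 0 0.
  by rewrite mxE; apply: eq_bigr => i _; rewrite mxE.
rewrite dotE linearZ /= -scalemxAr mxE; congr (_ * _).
rewrite trmx_mul trmxK mulmxA tr_row_mx.
rewrite -[w *m Q](hsubmxK (w *m Q : 'rV[R]_(1 + n))).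
rewrite mul_row_col trmx1 mulmx1 mxE; congr (_ + _).
  rewrite mxE /chart_head; congr (_ _ _); exact: val_inj.
by rewrite mxE -sumrN; apply: eq_bigr => i _; rewrite !mxE mulrN.
Qed.

(** The normal is a nonzero multiple of [(1, - grad g)] in the chart, so orthogonality says that
    [grad g] paired with the tail of [w] is its head; differentiability of [g] turns this pairing
    into a directional derivative. *)
Lemma normal_orthogonal_tangent (R : realType) (n : nat)
    (Omega : set 'rV[R]_n.+1) (x nu w : 'rV[R]_n.+1) :
  open Omega -> boundary Omega x -> outward_unit_normal Omega x nu ->
  dotv w nu = 0 -> tangent_at (boundary Omega) x w.
Proof.
move=> oO bx [r [Q [g [chart dg ->]]]].
set y := rsubmx _ in dg *.
have yE : y = chart_tail Q x by [].
rewrite dotv_chart => /eqP; rewrite mulf_eq0 => /orP[|].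
  rewrite invr_eq0 sqrtr_eq0 leNgt => /negP[].
  apply: ltr_pwDl => //; apply: sumr_ge0 => i _.
  by rewrite -expr2 sqr_ge0.
rewrite subr_eq0 => /eqP hdw.
have [r0 _ _ _] := chart.
have xr : `|x - x| < r by rewrite subrr normr0.
apply/(tangent_graphP oO chart) => // e e0.
have dk : derivable g y (chart_tail Q w) by exact: diff_derivable.
have := @derivable_has_deriv _ _ _ g y (chart_tail Q w) 0.
rewrite scale0r addr0 => /(_ dk e e0) [d d0 dP].
exists d => // h /dP; rewrite add0r scale0r addr0.
suff -> : 'D_(chart_tail Q w) g y = chart_head Q w by [].
rewrite hdw deriveE //.
rewrite {1}[chart_tail Q w]row_sum_delta linear_sum; apply: eq_bigr => i _.
rewrite linearZ /=; congr (_ * _).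
by rewrite [RHS]mxE deriveE.
Qed.

(** * Lipschitz domains *)

Lemma ler_norm_enorm (R : realType) (n : nat) (x : 'rV[R]_n) : `|x| <= enorm x.
Proof.
apply: rV_norm_leP => [|i]; first exact: sqrtr_ge0.
rewrite -sqrtr_sqr; apply: ler_wsqrtr; rewrite /dotv (bigD1 i) //= expr2 lerDl.
by apply: sumr_ge0 => j _; rewrite -expr2 sqr_ge0.
Qed.

(** One scale is enough: the premeasure at scale 1 is at most the measure. Euclidean diameters
    dominate those in the sup norm. *)
Lemma hausdorff_null_cover (R : realType) (n d : nat) (A : set 'rV[R]_n) (e : R) :
  hausdorff_measure d A = 0%E -> 0 < e ->
  exists (I : set nat) (U : nat -> set 'rV[R]_n) (r : nat -> R),
    [/\ A `<=` \bigcup_(i in I) U i, forall i, I i -> 0 <= r i,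
        forall i, I i -> forall x y, U i x -> U i y -> `|x - y| <= r i &
        (\esum_(i in I) (r i ^+ d)%:E < e%:E)%E].
Proof.
move=> A0 e0.
have : (hausdorff_pre d 1 A < e%:E)%E.
  apply: (@le_lt_trans _ _ 0%E); last by rewrite lte_fin.
  by rewrite -A0; apply: ereal_sup_ubound; exists 1 => //=.
move=> /ereal_inf_lt[_ [I [U [r [AU r1 rU ->]]]] lt].
exists I, U, r; split=> // [i /r1 /andP[]//|i Ii x y Ux Uy].
exact: le_trans (ler_norm_enorm _) (rU i Ii x y Ux Uy).
Qed.

(** Each piece of a cover costs [r ^+ 0 = 1], so a cover of total cost below 1 has no pieces. *)
Lemma hausdorff0_null (R : realType) (n : nat) (A : set 'rV[R]_n) :
  hausdorff_measure 0 A = 0%E -> A = set0.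
Proof.
move=> /hausdorff_null_cover /(_ ltr01)[I [U [r [AU _ _ lt]]]].
apply/seteqP; split=> // x /AU[i Ii _].
suff : (1%:E < 1%:E :> \bar R)%E by rewrite ltxx.
apply: le_lt_trans lt; apply: esum_ge; exists [set i].
  by split; [exact: finite_set1 | move=> _ ->].
by rewrite fsbig_set1 expr0.
Qed.

Lemma hausdorff_null_balls (R : realType) (n d : nat) (A : set 'rV[R]_n) (e : R) :
  hausdorff_measure d.+1 A = 0%E -> 0 < e ->
  exists (c : nat -> 'rV[R]_n) (r : nat -> R),
    [/\ forall i, 0 <= r i, (\sum_(i <oo) (r i ^+ d.+1)%:E <= e%:E)%E &
        forall x, A x -> exists i, `|x - c i| <= r i].
Proof.
move=> A0 e0; have [I [U [r [AU r0 rU lt]]]] := hausdorff_null_cover A0 e0.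
pose c i := xget 0 (U i).
pose s i := if i \in I then r i else 0.
exists c, s; split.
- by move=> i; rewrite /s; case: ifPn => // /set_mem /r0.
- apply: ltW; apply: le_lt_trans lt.
  have -> : (\esum_(i in I) (r i ^+ d.+1)%:E)%E =
      (\esum_(i in [set x | x \in I]) (s i ^+ d.+1)%:E)%E.
    have -> : [set x | x \in I] = I.
      by apply/seteqP; split=> x /=; [move=> /set_mem | move=> /mem_set].
    by apply: eq_esum => i Ii; rewrite /s mem_set.
  rewrite -nneseries_esum; last first.
    by move=> i iI; rewrite lee_fin exprn_ge0 // /s iI; apply: r0; exact: set_mem.
  rewrite [leRHS]eseries_mkcond; apply: lee_nneseries => [i _ _|i _].
    by rewrite lee_fin exprn_ge0 // /s; case: ifPn => // /set_mem /r0.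
  by case: ifPn => // iI; rewrite /s (negbTE iI) expr0n.
- move=> x /AU[i Ii Ux]; exists i; rewrite /s mem_set //.
  by apply: rU => //; rewrite /c; exact: (xgetI 0 Ux).
Qed.

Lemma tangent_everywhere (R : realType) (n : nat) (Omega : set 'rV[R]_n.+1)
    (w : 'rV[R]_n.+1 -> 'rV[R]_n.+1) (P : 'rV[R]_n.+1 -> Prop) :
  open Omega ->
  (forall p, boundary Omega p ->
    exists r Q g, lipschitz_graph_at Omega p r Q g) ->
  (forall p, boundary Omega p -> forall e, 0 < e -> exists2 d, 0 < d &
    forall x, boundary Omega x -> `|x - p| < d -> `|w x - w p| <= e) ->
  ae_boundary Omega P ->
  (forall x, boundary Omega x -> P x -> tangent_at (boundary Omega) x (w x)) ->
  forall p, boundary Omega p -> tangent_at (boundary Omega) p (w p).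
Proof.
(* In ambient dimension one the exceptional set is null for the counting measure, hence empty; the
   argument with lines needs a tangential variable. *)
case: n Omega w P => [|m] O v A openO charts cv null tanA p bp.
  apply: tanA => //; apply: contrapT => nA; have := hausdorff0_null null.
  by move=> /seteqP[/(_ p) + _]; apply.
have [r [Q [g chart]]] := charts p bp.
have pp : `|p - p| < r by rewrite subrr normr0; case: chart.
apply/(tangent_graphP openO chart) => // e e0.
have [r0 QQt lipg _] := chart.
have [L L0 LP] := lipschitzP lipg.
have [C C1 [Chd Ctl Cpt]] := chart_norm_bound Q.
set hd := chart_head Q in Chd *; set tl := chart_tail Q in Ctl *.
set pt := chart_point Q in Cpt *.
set z0 := tl p; set u := hd (v p); set u' := tl (v p).
have pE : hd p = g z0 by apply/(chart_boundary openO chart).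
have C0 : 0 <= C by lra.
have L10 : 0 < L + 1 by lra.
(* The budget in units of [e / 8]: one for exchanging [u'] and [d] at the end; within the slope
   [e / 2], one each for the remainder of tangency, for [d] against [u'], and for the variation of
   [v] near [p]. *)
pose tau := e / 8 / (L + 1).
have tau0 : 0 < tau by rewrite !divr_gt0.
have tauE : tau * (L + 1) = e / 8 by rewrite divfK // gt_eqF.
(* Lines in the direction d must be transversal to the hyperplanes z_0 = const,
   hence the perturbation of u'. *)
have [d d0 du] : exists2 d : 'rV[R]_m.+1, d 0 0 != 0 & `|d - u'| <= tau.
  case: (eqVneq (u' 0 0) 0) => [u0|]; last first.
    by exists u' => //; rewrite subrr normr0 ltW.
  have addE (x : 'rV[R]_m.+1) : (x + tau *: delta_mx 0 0) 0 0 = x 0 0 + tau.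
    by rewrite !mxE !eqxx mulr1.
  exists (u' + tau *: delta_mx 0 0); first by rewrite addE u0 add0r gt_eqF.
  rewrite addrAC subrr add0r normrZ gtr0_norm // -[leRHS]mulr1.
  apply: ler_wpM2l; first exact: ltW.
  by apply: rV_norm_leP => // i; rewrite mxE; case: (_ && _); rewrite ?normr1 ?normr0.
pose e1 := e / 8 / (L + 1) / C.
have e10 : 0 < e1 by rewrite !divr_gt0 //; lra.
have e1E : C * e1 * (L + 1) = e / 8.
  by rewrite /e1 [C * _]mulrC divfK ?divfK ?gt_eqF //; lra.
have [R0 R00 R0P] := cv p bp e1 e10.
(* Graph points over the ball of radius [rho0] about [z0] lie within [Rm] of [p], where both the
   chart and the closeness of [v] to [v p] are available. *)
pose Rm := Num.min r R0.
have Rm0 : 0 < Rm by rewrite lt_min r0.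
have CL0 : 0 < C * (1 + L) by apply: mulr_gt0; lra.
pose rho0 := Rm / (C * (1 + L)).
have rho00 : 0 < rho0 by exact: divr_gt0.
have RmE : Rm = C * (1 + L) * rho0 by rewrite mulrC divfK // gt_eqF.
pose G z := pt (g z) z.
have hdG z : hd (G z) = g z by exact: chart_head_point.
have tlG z : tl (G z) = z by exact: chart_tail_point.
have Gp z : `|z - z0| < rho0 -> `|G z - p| < Rm.
  move=> zz; rewrite -(chart_pointK QQt p) chart_pointB -/tl -/hd -/z0 pE.
  apply: le_lt_trans (Cpt _ _) _; rewrite RmE -mulrA ltr_pM2l //; last by lra.
  have h1 := LP z z0.
  have h2 : (1 + L) * `|z - z0| < (1 + L) * rho0 by rewrite ltr_pM2l //; lra.
  by move: h1; move: (`|g z - g z0|) => G1; lra.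
have Gr z : `|z - z0| < rho0 -> `|G z - p| < r.
  by move=> /Gp; rewrite lt_min => /andP[].
have GB z : `|z - z0| < rho0 -> boundary O (G z).
  by move=> zz; apply/(chart_boundary openO chart (Gr z zz)); rewrite -/hd -/tl hdG tlG.
have nd0 := normr_ge0 d.
pose dh := rho0 / 2 / (`|d| + 1).
exists dh; first by rewrite !divr_gt0 //; lra.
move=> h hdh.
have hd2 : `|h| * `|d| < rho0 / 2.
  apply: (@le_lt_trans _ _ (`|h| * (`|d| + 1))).
    by apply: ler_wpM2l => //; lra.
  by rewrite -ltr_pdivlMr //; lra.
suff main : `|g (z0 + h *: d) - g z0 - h * u| <= e / 2 * `|h|.
  have h1 := LP (z0 + h *: u') (z0 + h *: d).
  have h2 : L * `|z0 + h *: u' - (z0 + h *: d)| <= e / 8 * `|h|.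
    have -> : z0 + h *: u' - (z0 + h *: d) = - (h *: (d - u')).
      by apply/rowP => i; rewrite !mxE; ring.
    rewrite normrN normrZ mulrCA [leRHS]mulrC; apply: ler_wpM2l => //.
    rewrite -tauE mulrC; apply: ler_pM => //; lra.
  have -> : g (z0 + h *: u') - g z0 - h * u = (g (z0 + h *: u') - g (z0 + h *: d)) +
    (g (z0 + h *: d) - g z0 - h * u) by ring.
  apply: le_trans (ler_normD _ _) _.
  by move: h1 h2 main (mulr_ge0 (ltW e0) (normr_ge0 h)); clear; lra.
(* With [h] fixed, [eta] pays for moving the line from [z0] to [z] (a quarter at each end, through
   [rho]) and for the length cut off by the cover (one half, through [etal]). *)
apply/ler_addgt0Pr => eta eta0.
pose K := L * `|d| + `|u|.
have K0 : 0 <= K by rewrite addr_ge0 // mulr_ge0.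
pose rho := Num.min (rho0 / 2) (eta / 4 / (L + 1)).
have rho_0 : 0 < rho by rewrite lt_min !divr_gt0.
have rho1 : rho <= rho0 / 2 by rewrite ge_min lexx.
have rho2 : L * rho <= eta / 4.
  apply: (@le_trans _ _ ((L + 1) * (eta / 4 / (L + 1)))).
    by apply: ler_pM => //; [exact: ltW|lra|rewrite ge_min lexx orbT].
  by rewrite mulrC divfK // gt_eqF.
pose etal := eta / 4 / (K + 1).
have K10 : 0 < K + 1 by rewrite ltr_wpDl.
have etal0 : 0 < etal by rewrite !divr_gt0.
have etal2 : K * (2 * etal) <= eta / 2.
  apply: (@le_trans _ _ ((K + 1) * (2 * etal))).
    by apply: ler_wpM2r; [rewrite mulr_ge0 // ltW | rewrite lerDl].
  have -> : (K + 1) * (2 * etal) = etal * (K + 1) * 2 by ring.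
  by rewrite /etal divfK ?gt_eqF //; clear; lra.
have [delta delta0 deltaP] := short_cover_line z0 d0 rho_0 etal0.
have Cm0 : 0 < C ^+ m.+1 by rewrite exprn_gt0 //; exact: lt_le_trans C1.
have [c [rc [rc0 rcsum rcP]]] := hausdorff_null_balls null (divr_gt0 delta0 Cm0).
have [||z [q [l [zz0 l0 lsum lP]]]] := deltaP (fun i => tl (c i)) (fun i => C * rc i).
- by move=> i; rewrite mulr_ge0.
- under eq_eseriesr do rewrite exprMn EFinM.
  rewrite nneseriesZl; last by move=> i _; rewrite lee_fin exprn_ge0.
  apply: le_trans (lee_wpmul2l _ rcsum) _; first by rewrite lee_fin ltW.
  by rewrite -EFinM lee_fin mulrC divfK // gt_eqF.
(* The deviation of [g] along the auxiliary line from the expected slope [u]. *)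
pose phi s := g (z + s *: d) - s * u.
have phiK s t : `|phi s - phi t| <= K * `|s - t|.
  have -> : phi s - phi t = (g (z + s *: d) - g (z + t *: d)) - (s - t) * u.
    by rewrite /phi; ring.
  apply: le_trans (ler_normB _ _) _; rewrite /K (mulrDl _ _ `|s - t|); apply: lerD.
    apply: le_trans (LP _ _) _.
    have -> : z + s *: d - (z + t *: d) = (s - t) *: d.
      by apply/rowP => i; rewrite !mxE; ring.
    by rewrite normrZ -mulrA [`|d| * _]mulrC.
  by rewrite normrM mulrC.
have close s : `|s| <= `|h| -> `|z + s *: d - z0| < rho0.
  move=> sh; have -> : z + s *: d - z0 = (z - z0) + s *: d by rewrite addrAC.
  apply: le_lt_trans (ler_normD _ _) _; rewrite normrZ.
  by move: (ler_wpM2r nd0 sh) zz0 rho1 hd2; clear; lra.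
have slope s : `|s| <= `|h| -> (exists i, `|s - q i| <= l i) \/
    exists2 r, 0 < r & forall k, 0 < k < r -> `|phi (s + k) - phi s| <= e / 2 * k.
  move=> sh; have xz := close s sh.
  pose x := G (z + s *: d).
  have [Ax|nAx] := pselect (A x); last first.
    left; have [i xi] := rcP x (conj (GB _ xz) nAx).
    exists i; apply: lP; rewrite -[z + s *: d]tlG -chart_tailB.
    by apply: le_trans (Ctl _) _; apply: ler_wpM2l.
  right.
  have e80 : 0 < e / 8 by rewrite divr_gt0.
  have tx := tanA x (GB _ xz) Ax.
  have [k k0 kP] := (tangent_graphP openO chart (v x) (Gr _ xz) (GB _ xz)).1 tx _ e80.
  exists k => // j /andP[j0 jk].
  have := kP j; rewrite gtr0_norm // => /(_ jk).
  rewrite -/tl -/hd tlG => h1.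
  have vx : `|v x - v p| <= e1.
    by apply: R0P; [exact: GB | have := Gp _ xz; rewrite lt_min => /andP[]].
  have h2 : `|hd (v x) - u| <= C * e1.
    rewrite /u -chart_headB; apply: le_trans (Chd _) _; exact: ler_wpM2l.
  have h3 : `|tl (v x) - u'| <= C * e1.
    rewrite /u' -chart_tailB; apply: le_trans (Ctl _) _; exact: ler_wpM2l.
  have -> : phi (s + j) - phi s =
      (g (z + (s + j) *: d) - g (z + s *: d + j *: tl (v x))) +
      ((g (z + s *: d + j *: tl (v x)) - g (z + s *: d) - j * hd (v x)) +
       j * (hd (v x) - u)) by rewrite /phi; ring.
  apply: le_trans (ler_normD _ _) _.
  have h4 := ler_normD (g (z + s *: d + j *: tl (v x)) - g (z + s *: d) - j * hd (v x))
    (j * (hd (v x) - u)).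
  rewrite [X in _ <= _ + X]normrM gtr0_norm // in h4.
  have h5 := LP (z + (s + j) *: d) (z + s *: d + j *: tl (v x)).
  have E5 : z + (s + j) *: d - (z + s *: d + j *: tl (v x)) =
      j *: ((d - u') - (tl (v x) - u')).
    by apply/rowP => i; rewrite !mxE; ring.
  rewrite E5 normrZ gtr0_norm // in h5.
  have h6 : `|(d - u') - (tl (v x) - u')| <= tau + C * e1.
    by apply: le_trans (ler_normB _ _) _; exact: lerD.
  have h7 : L * (j * `|(d - u') - (tl (v x) - u')|) <= j * (L * (tau + C * e1)).
    by rewrite mulrCA; apply: ler_wpM2l; [exact: ltW | exact: ler_wpM2l].
  have h8 : j * `|hd (v x) - u| <= j * (C * e1).
    by apply: ler_wpM2l => //; exact: ltW.
  have h9 : j * (L * (tau + C * e1) + C * e1) <= j * (e / 4).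
    apply: ler_wpM2l; first exact: ltW.
    have -> : L * (tau + C * e1) + C * e1 = tau * (L + 1) - tau + C * e1 * (L + 1) by ring.
    rewrite tauE e1E; move: e0 tau0; clear; lra.
  have je : 0 < j * e by exact: mulr_gt0.
  move: h1 h4 h5 h7 h8 h9 je; clear; lra.
have phib : `|phi h - phi 0| <= e / 2 * `|h| + K * (2 * etal).
  have incr a b : a <= b -> `|a| <= `|h| -> `|b| <= `|h| -> b - a = `|h| ->
      `|phi b - phi a| <= e / 2 * `|h| + K * (2 * etal).
    move=> ab ah bh <-; apply: (increment_off_intervals K0 _ phiK l0 lsum _ ab).
      by rewrite divr_ge0 // ltW.
    move=> s sab; apply: slope; move: sab ah bh; rewrite !ler_norml; clear; lra.
  have [h0|h0] := lerP 0 h.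
    by apply: incr; rewrite ?normr0 ?subr0 ?ger0_norm.
  by rewrite distrC; apply: incr; rewrite ?normr0 ?sub0r ?ltr0_norm // ?ltW ?oppr_gt0.
have z0z : `|z0 - z| <= rho by rewrite distrC.
have g1 : `|g (z0 + h *: d) - g (z + h *: d)| <= eta / 4.
  apply: le_trans (LP _ _) _; rewrite opprD addrACA subrr addr0.
  by apply: le_trans rho2; exact: ler_wpM2l.
have g2 : `|g z - g z0| <= eta / 4.
  by apply: le_trans (LP _ _) _; apply: le_trans rho2; exact: ler_wpM2l.
have -> : g (z0 + h *: d) - g z0 - h * u = (g (z0 + h *: d) - g (z + h *: d)) +
    ((phi h - phi 0) + (g z - g z0)).
  by rewrite /phi scale0r addr0; ring.
apply: le_trans (ler_normD _ _) _.
move: (ler_normD (phi h - phi 0) (g z - g z0)) phib g1 g2 etal2; clear; lra.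
Qed.

(** * Local quasi-convexity of Lipschitz domains *)

Definition segment_in (R : realType) (V : normedModType R) (A : set V) (a b : V) :=
  forall s : R, 0 <= s <= 1 -> A (a + s *: (b - a)).

(** The chord between two points below the graph may cross it. Moving down by a multiple of
    [|b - a|] first, then across, then up avoids the graph at a cost proportional to [|b - a|]. *)
Lemma closure_local_paths (R : realType) (n : nat) (Omega : set 'rV[R]_n.+1) p :
  open Omega ->
  (forall p, boundary Omega p -> exists r Q g, lipschitz_graph_at Omega p r Q g) ->
  closure Omega p ->
  exists2 rho, 0 < rho & exists2 D, 0 <= D & forall a b,
    Omega a -> Omega b -> `|a - p| < rho -> `|b - p| < rho ->
    exists c d, [/\ segment_in Omega a c, segment_in Omega c d &
      segment_in Omega d b] /\ [/\ `|c - a| <= D * `|b - a|,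
      `|d - c| <= D * `|b - a| & `|b - d| <= D * `|b - a|].
Proof.
move=> oO charts cp; have [Op|nOp] := pselect (Omega p).
  have /nbhs_normP[rho /= rho0 rhoP] : nbhs p Omega by apply: open_nbhs_nbhs.
  exists rho => //; exists 1 => // a b Oa Ob ap bp.
  exists a, b; split; last by rewrite !subrr normr0 mul1r.
  have cst x : Omega x -> segment_in Omega x x.
    by move=> Ox s _; rewrite subrr scaler0 addr0.
  split; [exact: cst | move=> s s01 | exact: cst].
  apply: rhoP; rewrite /= distrC.
  have -> : a + s *: (b - a) - p = (1 - s) *: (a - p) + s *: (b - p).
    by apply/rowP => i; rewrite !mxE; ring.
  apply: le_lt_trans (ler_normD _ _) _.
  rewrite !normrZ !ger0_norm; [|lra|lra].
  have [s0|s0] := lerP s (1 / 2).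
    have : (1 - s) * `|a - p| < (1 - s) * rho by rewrite ltr_pM2l //; lra.
    have : s * `|b - p| <= s * rho by apply: ler_wpM2l; lra.
    lra.
  have : (1 - s) * `|a - p| <= (1 - s) * rho by apply: ler_wpM2l; lra.
  have : s * `|b - p| < s * rho by rewrite ltr_pM2l //; lra.
  lra.
have bp : boundary Omega p by split=> //; rewrite (interior_id _).1.
have [r [Q [g chart]]] := charts p bp.
have [r0 QQt lipg _] := chart.
have [L L0 LP] := lipschitzP lipg.
have [C C1 [Chd Ctl Cpt]] := chart_norm_bound Q.
set hd := chart_head Q in Chd *; set tl := chart_tail Q in Ctl *.
pose E := chart_point Q 1 0.
have hdE : hd E = 1 by exact: chart_head_point.
have tlE : tl E = 0 by exact: chart_tail_point.
have nE : `|E| <= C by apply: le_trans (Cpt 1 0) _; rewrite normr1 normr0 addr0 mulr1.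
have C0 : 0 <= C by lra.
pose D := C * (C * (1 + L)).
have D1 : 1 <= D.
  have h1 : 1 * 1 <= C * (1 + L) by apply: ler_pM; lra.
  have h2 : 1 * (1 * 1) <= D by apply: ler_pM; lra.
  lra.
(* The middle segment goes farthest from [p]: less than [rho] to [a], at most [2 * rho] along
   [b - a], and at most [2 * D * rho] downwards. *)
exists (r / (3 + 2 * D)); first by apply: divr_gt0 => //; lra.
exists D; first by lra.
move=> a b Oa Ob; set rho := r / _ => ap bp'.
have rhoE : rho * (3 + 2 * D) = r by rewrite divfK // gt_eqF //; lra.
(* This descent makes up for the rise of the chord, at most [C * |b - a|], and for the fall of [g]
   under it, at most [L * C * |b - a|]. *)
pose S := C * (1 + L) * `|b - a|.
have S0 : 0 <= S by rewrite !mulr_ge0 //; lra.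
have SE s : 0 <= s <= 1 -> `|s *: (S *: E)| <= D * `|b - a|.
  move=> s01; have -> : `|s *: (S *: E)| = s * (S * `|E|).
    by rewrite !normrZ !ger0_norm //; lra.
  apply: (@le_trans _ _ (1 * (S * C))).
    have h1 := ler_wpM2l S0 nE.
    have h2 : 0 <= S * `|E| by rewrite mulr_ge0.
    have : s * (S * `|E|) <= 1 * (S * `|E|) by apply: ler_wpM2r => //; lra.
    lra.
  by rewrite /S /D; lra.
have ba : `|b - a| <= 2 * rho.
  have -> : b - a = (b - p) - (a - p) by rewrite opprB addrA subrK.
  by apply: le_trans (ler_normB _ _) _; lra.
have Dba : D * `|b - a| <= D * (2 * rho) by apply: ler_wpM2l; lra.
have rho_r : rho <= r.
  have := mulr_ge0 (ltac:(lra) : 0 <= D) (le_trans (normr_ge0 _) ba).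
  have := le_trans (normr_ge0 _) ba; rewrite -rhoE; lra.
have ra : `|a - p| < r by exact: lt_le_trans ap rho_r.
have rb : `|b - p| < r by exact: lt_le_trans bp' rho_r.
have ha := (chart_interior chart ra).1 Oa.
have hb := (chart_interior chart rb).1 Ob.
rewrite -/hd -/tl in ha hb.
have down s x : 0 <= s <= 1 -> Omega x -> `|x - p| < rho ->
    Omega (x - s *: (S *: E)).
  move=> s01 Ox xp.
  have rx : `|x - p| < r by exact: lt_le_trans xp rho_r.
  have hx := (chart_interior chart rx).1 Ox; rewrite -/hd -/tl in hx.
  apply/(chart_interior chart).
    rewrite addrAC; apply: le_lt_trans (ler_normB _ _) _.
    by have := SE s s01; have := normr_ge0 (x - p); rewrite -rhoE; lra.
  rewrite chart_headB chart_tailB !chart_headZ !chart_tailZ -/hd -/tl hdE tlE.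
  rewrite !scaler0 subr0.
  have := mulr_ge0 (ltac:(lra) : 0 <= s) S0; lra.
exists (a - S *: E), (b - S *: E).
have SE1 : `|S *: E| <= D * `|b - a|.
  by have := SE 1; rewrite scale1r; apply; rewrite ler01 lexx.
split; split.
- move=> s s01.
  have -> : a + s *: (a - S *: E - a) = a - s *: (S *: E).
    by rewrite addrAC subrr add0r scalerN.
  exact: down.
- move=> s s01.
  have -> : a - S *: E + s *: (b - S *: E - (a - S *: E)) =
      a + s *: (b - a) - S *: E.
    by apply/rowP => i; rewrite !mxE; ring.
  apply/(chart_interior chart).
    have -> : a + s *: (b - a) - S *: E - p = (a - p) + (s *: (b - a) - S *: E).
      by apply/rowP => i; rewrite !mxE; ring.
    apply: le_lt_trans (ler_normD _ _) _.
    have := ler_normB (s *: (b - a)) (S *: E).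
    rewrite normrZ ger0_norm; last by lra.
    have : s * `|b - a| <= 1 * `|b - a| by apply: ler_wpM2r => //; lra.
    by rewrite -rhoE; lra.
  rewrite chart_headB chart_headD chart_headZ chart_headB.
  rewrite chart_tailB chart_tailD chart_tailZ chart_tailB !chart_headZ !chart_tailZ.
  rewrite -/hd -/tl hdE tlE scaler0 subr0 mulr1.
  have h1 := LP (tl a + s *: (tl b - tl a)) (tl a).
  have h2 := Ctl (b - a); have h3 := Chd (b - a).
  rewrite /tl chart_tailB -/tl in h2; rewrite /hd chart_headB -/hd in h3.
  have h4 : `|tl a + s *: (tl b - tl a) - tl a| <= C * `|b - a|.
    rewrite addrAC subrr add0r normrZ ger0_norm; last by lra.
    apply: le_trans h2; rewrite -[leRHS]mul1r; apply: ler_wpM2r => //; lra.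
  have h5 := ler_wpM2l L0 h4.
  have h6 : s * (hd b - hd a) <= C * `|b - a|.
    apply: le_trans (ler_norm _) _; rewrite normrM ger0_norm; last by lra.
    apply: le_trans h3; rewrite -[leRHS]mul1r; apply: ler_wpM2r => //; lra.
  move: (le_trans h1 h5); rewrite ler_norml /S; lra.
- move=> s s01.
  have -> : b - S *: E + s *: (b - (b - S *: E)) = b - (1 - s) *: (S *: E).
    by apply/rowP => i; rewrite !mxE; ring.
  by apply: down => //; lra.
- by rewrite addrAC subrr add0r normrN.
- have -> : b - S *: E - (a - S *: E) = b - a by apply/rowP => i; rewrite !mxE; ring.
  by rewrite -[leLHS]mul1r; exact: ler_wpM2r.
- by rewrite opprB addrC subrK.
Qed.

(** Near pairs are joined by three segments, giving [3 * M * D]; for pairs at distance at least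
    [rho / 2] boundedness gives [4 * B / rho]. Compactness makes the constant uniform, and it is
    chosen before [f] so as to serve [v] at all times. *)
Lemma lipschitz_of_segments (R : realType) (n : nat) (Omega : set 'rV[R]_n.+1)
    (W : normedModType R) (M B : R) :
  open Omega -> compact (closure Omega) ->
  (forall p, boundary Omega p -> exists r Q g, lipschitz_graph_at Omega p r Q g) ->
  0 <= M -> 0 <= B ->
  exists2 C, 0 <= C & forall f : 'rV[R]_n.+1 -> W,
    (forall a b, segment_in Omega a b -> `|f b - f a| <= M * `|b - a|) ->
    (forall a, Omega a -> `|f a| <= B) ->
    forall a b, Omega a -> Omega b -> `|f a - f b| <= C * `|a - b|.
Proof.
move=> oO /compact_near_coveringP cK charts M0 B0.
pose P C a := forall f : 'rV[R]_n.+1 -> W,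
    (forall a b, segment_in Omega a b -> `|f b - f a| <= M * `|b - a|) ->
    (forall a, Omega a -> `|f a| <= B) ->
    Omega a -> forall b, Omega b -> `|f a - f b| <= C * `|a - b|.
have : \forall C \near +oo, closure Omega `<=` P C.
  apply: cK => p cp.
  have [rho rho0 [D D0 paths]] := closure_local_paths oO charts cp.
  have rho20 : 0 < rho / 2 by lra.
  exists ([set a | `|a - p| < rho / 2], [set C | 3 * M * D + 4 * B / rho <= C]) => /=.
    split; last by apply: nbhs_pinfty_ge; exact: num_real.
    exact: nbhs_norm_lt.
  move=> [a C] /= [ap CC] f fseg fB Oa b Ob.
  have MD0 : 0 <= 3 * M * D by rewrite !mulr_ge0.
  have Br0 : 0 <= 4 * B / rho by apply: divr_ge0; lra.
  have [ab|ab] := ltrP `|a - b| (rho / 2).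
    have bp : `|b - p| < rho.
      have -> : b - p = (a - p) - (a - b) by rewrite opprB [RHS]addrC addrA subrK.
      by apply: le_lt_trans (ler_normB _ _) _; lra.
    have [c [d [[s1 s2 s3] [l1 l2 l3]]]] := paths a b Oa Ob ltac:(lra) bp.
    have t1 := le_trans (fseg _ _ s1) (ler_wpM2l M0 l1).
    have t2 := le_trans (fseg _ _ s2) (ler_wpM2l M0 l2).
    have t3 := le_trans (fseg _ _ s3) (ler_wpM2l M0 l3).
    rewrite [`|f a - f b|]distrC [`|a - b|]distrC.
    have -> : f b - f a = (f b - f d) + ((f d - f c) + (f c - f a)).
      by rewrite (addrA (f d - f c)) subrK addrA subrK.
    apply: le_trans (ler_normD _ _) _.
    apply: le_trans (lerD (lexx _) (ler_normD _ _)) _.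
    apply: (@le_trans _ _ (3 * M * D * `|b - a|)); first by lra.
    by apply: ler_wpM2r => //; lra.
  apply: le_trans (ler_normB _ _) _.
  apply: (@le_trans _ _ (4 * B / rho * (rho / 2))).
    have -> : 4 * B / rho * (rho / 2) = 2 * B.
      by rewrite mulrA divfK ?gt_eqF //; lra.
    by have := fB a Oa; have := fB b Ob; lra.
  by apply: ler_pM => //; [exact: ltW | lra].
move=> /(filterI (nbhs_pinfty_ge (num_real (0 : R)))) /filter_ex[C [C0 CP]].
exists C => // f fseg fB a b Oa Ob.
exact: (CP a (subset_closure Oa) f fseg fB Oa b Ob).
Qed.

(** * The vector field *)

(** The projection of the line onto [[0, 1]]: composing with it turns fields and curves given on
    [[0, 1]] into globally continuous ones. *)
Definition clamp (R : realType) (t : R) : R := Num.max 0 (Num.min t 1).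

Lemma clamp_bounds (R : realType) (t : R) : 0 <= clamp t <= 1.
Proof. by rewrite /clamp le_max lexx /= ge_max ler01 /= ge_min lexx orbT. Qed.

Lemma clamp_id (R : realType) (t : R) : 0 <= t <= 1 -> clamp t = t.
Proof. by move=> /andP[t0 t1]; rewrite /clamp min_l // max_r. Qed.

Lemma clamp_lip (R : realType) (s t : R) : `|clamp s - clamp t| <= `|s - t|.
Proof.
rewrite /clamp; have [s1|s1] := lerP s 1; have [t1|t1] := lerP t 1.
- have [s0|s0] := lerP 0 s; have [t0|t0] := lerP 0 t => //;
    by rewrite ?subrr ?normr0 // !ler_norml; move: (ler_norm (s - t));
    have := ler_norm (t - s); rewrite distrC; lra.
- rewrite (max_r ler01); have [s0|s0] := lerP 0 s;
    have := ler_norm (t - s); rewrite (distrC t) ler_norml; lra.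
- rewrite (max_r ler01); have [t0|t0] := lerP 0 t;
    have := ler_norm (s - t); rewrite ler_norml; lra.
- by rewrite subrr normr0.
Qed.

Lemma clamp_continuous (R : realType) (V : normedModType R) (x : R -> V) :
  {within `[0, 1], continuous x} -> continuous (fun t => x (clamp t)).
Proof.
move=> /within_continuousP cx t; apply/continuous_atP => e e0.
have D (s : R) : `[0, 1]%classic (clamp s) by rewrite /= in_itv /=; exact: clamp_bounds.
have [r r0 rP] := cx _ (D t) e e0.
exists r => // s sr; apply: rP => //.
by apply: le_lt_trans sr; exact: clamp_lip.
Qed.

Lemma pair_norm_lt (R : realType) (V W : normedModType R) (x : V * W) e :
  `|x| < e <-> `|x.1| < e /\ `|x.2| < e.
Proof. by rewrite prod_normE gt_max; split=> [/andP[]|[-> ->]]. Qed.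

Lemma closure_cylinder (R : realType) (V : normedModType R) (A : set V) x t :
  closure (A `*` [set t : R | 0 < t < 1]) (x, t) <-> closure A x /\ 0 <= t <= 1.
Proof.
split=> [/closure_normP cl|[/closure_normP cx t01]].
- split.
    apply/closure_normP => e /cl[[y s] [/= Ay _] /pair_norm_lt[/= yx _]].
    by exists y.
  apply/andP; split; apply/ler_addgt0Pr => e /cl[[y s] [/= _ s01]];
    move=> /pair_norm_lt[_ /=]; rewrite ltr_norml; lra.
- apply/closure_normP => e e0; have [y Ay yx] := cx e e0.
  pose d := Num.min (1 / 2) (e / 2).
  have d0 : 0 < d by rewrite lt_min; apply/andP; split; lra.
  have d1 : d <= 1 / 2 by rewrite ge_min lexx.
  have de : d <= e / 2 by rewrite ge_min lexx orbT.
  (* Pulling [t] towards 1/2 brings it into the open interval. *)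
  exists (y, (1 - d) * t + d / 2).
    split=> //=; have h1 : 0 <= (1 - d) * t by apply: mulr_ge0; lra.
    have h2 : (1 - d) * t <= (1 - d) * 1 by apply: ler_wpM2l; lra.
    lra.
  apply/pair_norm_lt; split=> //=.
  have -> : (1 - d) * t + d / 2 - t = d * (1 / 2 - t) by field.
  rewrite normrM gtr0_norm //; apply: (@le_lt_trans _ _ (d * 1)); last by lra.
  by apply: ler_wpM2l; [exact: ltW | rewrite ler_norml; lra].
Qed.

Lemma bounded_closure_compact (R : realType) (n : nat) (A : set 'rV[R]_n) :
  bounded_set A -> compact (closure A).
Proof.
move=> [N [_ NP]]; apply: bounded_closed_compact; last exact: closed_closure.
exists (`|N| + 2); split; first exact: num_real.
move=> M MN x /closure_normP /(_ 1 ltr01)[y Ay yx].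
have h := NP (`|N| + 1) _ y Ay.
have {h} /h : N < `|N| + 1 by have := ler_norm N; lra.
move=> /= yN; have -> : x = y - (y - x) by rewrite opprB addrC subrK.
by apply: le_trans (ler_normB _ _) _; lra.
Qed.

Lemma compact_boundary (R : realType) (n : nat) (A : set 'rV[R]_n) :
  compact (closure A) -> compact (boundary A).
Proof.
move=> cA; apply: (subclosed_compact _ cA); last by move=> x [].
rewrite /boundary setDE; apply: closedI; first exact: closed_closure.
by apply: open_closedC; exact: open_interior.
Qed.

Section field.
Variables (R : realType) (n : nat) (Omega : set 'rV[R]_n.+1)
  (v : 'rV[R]_n.+1 * R -> 'rV[R]_n.+1)
  (g : 'I_n.+1 -> 'rV[R]_n.+1 * R -> 'rV[R]_n.+1).

Let K := closure Omega.
Let I01 := [set t : R | 0 < t < 1].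
Let D := closure (Omega `*` I01).

Hypotheses (oO : open Omega) (bO : bounded_set Omega) (neO : Omega !=set0)
  (charts : forall p, boundary Omega p ->
    exists r Q g, lipschitz_graph_at Omega p r Q g)
  (cv : {within D, continuous v})
  (dv : forall x, (Omega `*` I01) x -> differentiable v x)
  (cg : forall i, {within D, continuous (g i)})
  (Dg : forall i x, (Omega `*` I01) x -> 'D_(delta_mx 0 i, 0) v x = g i x).

(* g i stands for the continuous extension of the i-th spatial partial of v. *)
Definition spatial_diff (x : 'rV[R]_n.+1) (t : R) (k : 'rV[R]_n.+1) : 'rV[R]_n.+1 :=
  \sum_i k 0 i *: g i (x, t).

Lemma spatial_diffB x t k l :
  spatial_diff x t (k - l) = spatial_diff x t k - spatial_diff x t l.
Proof.
by rewrite /spatial_diff -sumrB; apply: eq_bigr => i _; rewrite !mxE scalerBl.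
Qed.

Lemma spatial_diff_sum (I : finType) x t (c : I -> R) (k : I -> 'rV[R]_n.+1) :
  spatial_diff x t (\sum_j c j *: k j) = \sum_j c j *: spatial_diff x t (k j).
Proof.
rewrite /spatial_diff; under [RHS]eq_bigr do rewrite scaler_sumr.
rewrite exchange_big; apply: eq_bigr => i _.
by rewrite summxE scaler_suml; apply: eq_bigr => j _; rewrite mxE scalerA.
Qed.

Lemma compact_cylinder : compact D.
Proof.
apply: (@subclosed_compact _ D (K `*` `[0, 1]%classic)).
- exact: closed_closure.
- by apply: compact_setX; [exact: bounded_closure_compact | exact: segment_compact].
by move=> [x t] /closure_cylinder[cx t01]; split=> //=; rewrite in_itv.
Qed.

Lemma inD x t : K x -> D (x, clamp t).
Proof. by move=> Kx; apply/closure_cylinder; split=> //; exact: clamp_bounds. Qed.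

Lemma spatial_diff_bound : exists2 M, 0 <= M &
  forall x t k, K x -> `|spatial_diff x (clamp t) k| <= M * `|k|.
Proof.
have H i := compact_norm_bounded compact_cylinder (@cg i).
have H' : forall i, exists M, 0 <= M /\ forall x, D x -> `|g i x| <= M.
  by move=> i; have [M M0 MP] := H i; exists M.
have [M MP] := choice H'.
exists (\sum_i M i) => [|x t k Kx]; first by apply: sumr_ge0 => i _; have [] := MP i.
apply: le_trans (ler_norm_sum _ _ _) _; rewrite mulr_suml; apply: ler_sum => i _.
have [M0 MiP] := MP i; rewrite normrZ mulrC; apply: ler_pM => //.
  by apply: MiP; exact: inD.
exact: ler_norm_coord.
Qed.

Lemma spatial_diff_unif e : 0 < e -> exists2 r, 0 < r &
  forall x y s t, K x -> K y -> `|x - y| < r -> `|s - t| < r ->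
  forall k, `|spatial_diff x (clamp s) k - spatial_diff y (clamp t) k| <= e * `|k|.
Proof.
move=> e0; have e'0 : 0 < e / n.+1%:R by apply: divr_gt0.
have H i := compact_unif_continuous compact_cylinder (@cg i) e'0.
have H' : forall i, exists r, 0 < r /\
    forall a b, D a -> D b -> `|a - b| < r -> `|g i a - g i b| <= e / n.+1%:R.
  by move=> i; have [r r0 rP] := H i; exists r.
have [r rP] := choice H'.
exists (\big[Num.min/1]_i r i).
  by apply: lt_bigmin => // i _; have [] := rP i.
move=> x y s t Kx Ky xy st k.
rewrite /spatial_diff -sumrB; apply: le_trans (ler_norm_sum _ _ _) _.
have -> : e * `|k| = \sum_(i < n.+1) e / n.+1%:R * `|k|.
  by rewrite sumr_const card_ord -mulrnAl -mulr_natr divfK ?pnatr_eq0.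
apply: ler_sum => i _; rewrite -scalerBr normrZ mulrC; apply: ler_pM => //.
  have [_ riP] := rP i; apply: riP; [exact: inD | exact: inD |].
  have ri : \big[Num.min/1]_i r i <= r i by exact: bigmin_le_cond.
  apply/pair_norm_lt; split=> /=; first exact: lt_le_trans xy ri.
  by apply: le_lt_trans (clamp_lip _ _) _; exact: lt_le_trans st ri.
exact: ler_norm_coord.
Qed.

Lemma v_unif e : 0 < e -> exists2 r, 0 < r &
  forall x y s t, K x -> K y -> `|x - y| < r -> `|s - t| < r ->
  `|v (x, clamp s) - v (y, clamp t)| <= e.
Proof.
move=> e0; have [r r0 rP] := compact_unif_continuous compact_cylinder cv e0.
exists r => // x y s t Kx Ky xy st; apply: rP; [exact: inD | exact: inD |].
apply/pair_norm_lt; split=> //=.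
by apply: le_lt_trans (clamp_lip _ _) _.
Qed.

Lemma v_bound : exists2 M, 0 <= M & forall x t, K x -> `|v (x, clamp t)| <= M.
Proof.
have [M M0 MP] := compact_norm_bounded compact_cylinder cv.
by exists M => // x t Kx; apply: MP; exact: inD.
Qed.

(** Differentiability of [v] makes its derivative along [(k, 0)] the linear combination of the
    coordinate derivatives, which [g] represents. *)
Lemma has_deriv_segment a k t s : 0 < t < 1 -> Omega (a + s *: k) ->
  has_deriv (fun s => v (a + s *: k, t)) s (spatial_diff (a + s *: k) t k).
Proof.
move=> t01 Oas.
have pE s' : (a, t) + s' *: (k, 0) = (a + s' *: k, t) :> 'rV[R]_n.+1 * R.
  by congr pair => /=; rewrite scaler0 addr0.
have In : (Omega `*` I01) (a + s *: k, t) by [].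
have dd : derivable v ((a, t) + s *: (k, 0)) (k, 0).
  by rewrite pE; apply: diff_derivable; exact: dv.
have := derivable_has_deriv dd.
have -> : 'D_(k, 0) v ((a, t) + s *: (k, 0)) = spatial_diff (a + s *: k) t k.
  rewrite pE deriveE; last exact: dv.
  have -> : (k, 0) = \sum_i k 0 i *: (delta_mx 0 i, 0) :> 'rV[R]_n.+1 * R.
    rewrite {1}[k]row_sum_delta; apply: injective_projections => /=.
      rewrite (big_morph (fun x : 'rV[R]_n.+1 * R => x.1) (id1 := 0)
        (op1 := +%R)) //.
    rewrite (big_morph (fun x : 'rV[R]_n.+1 * R => x.2) (id1 := 0)
      (op1 := +%R)) //.
    by rewrite big1 // => i _ /=; rewrite scaler0.
  rewrite linear_sum; apply: eq_bigr => i _.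
  by rewrite linearZ /= -Dg // deriveE //; exact: dv.
move=> H e /H[r r0 rP]; exists r => // h /rP.
by rewrite !pE.
Qed.

(** The free vector [c] gives two uses: [c = 0] for the Lipschitz bound, and the spatial
    differential at [a] applied to [b - a] for the first-order remainder. *)
Lemma v_increment a b t c N : 0 < t < 1 -> segment_in Omega a b -> 0 <= N ->
  (forall s, 0 < s < 1 ->
    `|spatial_diff (a + s *: (b - a)) t (b - a) - c| <= N) ->
  `|v (b, t) - v (a, t) - c| <= N.
Proof.
move=> t01 seg N0 H.
pose z s := v (a + clamp s *: (b - a), t) - clamp s *: c.
have tE : clamp t = t by apply: clamp_id; lra.
have cz : continuous z.
  apply: (@clamp_continuous _ _ (fun s => v (a + s *: (b - a), t) - s *: c)).
  apply/within_continuousP => s; rewrite /= in_itv /= => s01 e e0.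
  have e20 : 0 < e / 2 by lra.
  have [r r0 rP] := v_unif e20.
  have b10 : 0 < `|b - a| + 1 by have := normr_ge0 (b - a); lra.
  have c10 : 0 < `|c| + 1 by have := normr_ge0 c; lra.
  exists (Num.min (r / (`|b - a| + 1)) (e / 2 / (`|c| + 1))).
    by rewrite lt_min !divr_gt0.
  move=> s'; rewrite in_itv /= lt_min => s'01 /andP[]; rewrite !ltr_pdivlMr // => h1 h2.
  have -> : v (a + s' *: (b - a), t) - s' *: c - (v (a + s *: (b - a), t) - s *: c) =
      (v (a + s' *: (b - a), t) - v (a + s *: (b - a), t)) - (s' - s) *: c.
    by rewrite scalerBl !opprB addrACA [RHS]addrACA; congr (_ + _); rewrite addrC.
  apply: le_trans (ler_normB _ _) _; rewrite normrZ.
  have := rP (a + s' *: (b - a)) (a + s *: (b - a)) t t.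
  rewrite tE subrr normr0 opprD addrACA subrr add0r -scalerBl normrZ => h3.
  have {h3} := h3 (subset_closure (seg s' s'01)) (subset_closure (seg s s01)) _ r0.
  have n1 := normr_ge0 (s' - s); move=> h3.
  have := h3 ltac:(by lra); lra.
have z1 : z 1 = v (b, t) - c.
  by rewrite /z clamp_id ?lexx ?ler01 // !scale1r (addrC a) subrK.
have z0 : z 0 = v (a, t).
  by rewrite /z clamp_id ?lexx ?ler01 // !scale0r addr0 subr0.
have := @norm_increment_le R _ z (fun s => N * s) (fun=> N) 0 1 ler01 cz.
rewrite z1 z0 mulr0 subr0 mulr1 addrAC; apply.
  by move=> s; apply: cvgM; [exact: cvg_cst | exact: cvg_id].
move=> s s01; split.
  move=> e e0; exists 1 => // h _.
  have -> : N * (s + h) - N * s - h *: N = 0 by rewrite /GRing.scale /=; ring.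
  by rewrite normr0 mulr_ge0 // ltW.
exists (spatial_diff (a + s *: (b - a)) t (b - a) - c); last exact: H.
have Os : Omega (a + s *: (b - a)) by apply: seg; lra.
have := has_derivB (has_deriv_segment t01 Os) (_ : has_deriv (fun s => s *: c) s c).
move=> h; have {}h := h _; apply: (@has_deriv_near _ _ _ _ _ _ (Num.min s (1 - s))) (h _).
- by rewrite lt_min; lra.
- move=> s'; rewrite lt_min => /andP[]; rewrite !ltr_norml => h1 h2.
  by rewrite /z clamp_id //; lra.
- move=> e e0; exists 1 => // k _.
  by rewrite scalerDl [s *: c + _]addrC addrK subrr normr0 mulr_ge0 // ltW.
Qed.

Lemma v_lipschitz : exists2 C, 0 <= C & forall t a b, K a -> K b ->
  `|v (a, clamp t) - v (b, clamp t)| <= C * `|a - b|.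
Proof.
have [M M0 MP] := spatial_diff_bound.
have [B B0 BP] := v_bound.
have [C C0 CP] := @lipschitz_of_segments R n Omega 'rV[R]_n.+1 M B oO
  (bounded_closure_compact bO) charts M0 B0.
have inner t a b : 0 < t < 1 -> Omega a -> Omega b ->
    `|v (a, t) - v (b, t)| <= C * `|a - b|.
  move=> t01; apply: (CP (fun x => v (x, t))) => [x y seg|x Ox].
    rewrite -[v (y, t) - _]subr0; apply: v_increment => //; first by rewrite mulr_ge0.
    move=> s s01; rewrite subr0 -(clamp_id (_ : 0 <= t <= 1)); last by lra.
    by apply: MP; apply: subset_closure; apply: seg; lra.
  rewrite -(clamp_id (_ : 0 <= t <= 1)); last by lra.
  by apply: BP; exact: subset_closure.
(* From [Omega] and open times to the closure, by uniform continuity of [v]. *)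
exists C => // t a b Ka Kb; apply/ler_addgt0Pr => e e0.
have d0 : 0 < e / 4 by lra.
have [r r0 rP] := v_unif d0.
pose q := Num.min r (e / 4 / (C + 1)).
have q0 : 0 < q by rewrite lt_min r0 !divr_gt0 //; lra.
have qr : q <= r by rewrite ge_min lexx.
have qe : C * q <= e / 4.
  apply: (@le_trans _ _ ((C + 1) * (e / 4 / (C + 1)))).
    by apply: ler_pM; rewrite ?(ltW q0) //; [lra | rewrite ge_min lexx orbT].
  by rewrite mulrC divfK // gt_eqF //; lra.
have Da : D (a, clamp t) by exact: inD.
(* The time [s] in the open interval comes with the approximation of [a] and is reused for [b]. *)
have [[a' s] [/= Oa' s01] /pair_norm_lt[/= aa ss]] := (closure_normP _ _).1 Da q q0.
have [b' Ob' bb] := (closure_normP _ _).1 Kb q q0.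
have {}s01 : 0 < s < 1 by [].
have sE : clamp s = s by apply: clamp_id; lra.
have st : `|clamp t - s| < r by rewrite distrC; lra.
have tt : clamp (clamp t) = clamp t by apply: clamp_id; exact: clamp_bounds.
have h1 := rP a a' (clamp t) s Ka (subset_closure Oa')
  ltac:(by rewrite distrC; lra) st.
have h2 := rP b b' (clamp t) s Kb (subset_closure Ob')
  ltac:(by rewrite distrC; lra) st.
rewrite tt sE in h1 h2.
have h3 := inner s a' b' s01 Oa' Ob'.
have -> : v (a, clamp t) - v (b, clamp t) = (v (a, clamp t) - v (a', s)) +
    ((v (a', s) - v (b', s)) - (v (b, clamp t) - v (b', s))).
  by apply/rowP => i; rewrite !mxE; ring.
have h4 : `|a' - b'| <= `|a - b| + (q + q).
  have -> : a' - b' = (a - b) + ((a' - a) - (b' - b)).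
    by apply/rowP => i; rewrite !mxE; ring.
  apply: le_trans (ler_normD _ _) _; rewrite lerD2l.
  by apply: le_trans (ler_normB _ _) _; lra.
have h5 := ler_wpM2l C0 h4.
apply: le_trans (ler_normD _ _) _.
have := ler_normB (v (a', s) - v (b', s)) (v (b, clamp t) - v (b', s)); lra.
Qed.

Lemma v_extension : exists (V : 'rV[R]_n.+1 -> R -> 'rV[R]_n.+1) (C : R),
  [/\ 0 <= C, forall t y, K y -> V y t = v (y, clamp t),
      forall p q t, `|V p t - V q t| <= C * `|p - q|,
      forall x, continuous (V x) &
      forall x, exists B, forall t, `|V x t| <= B].
Proof.
have [C C0 CP] := v_lipschitz; have [B B0 BP] := v_bound.
have K0 : K !=set0 by have [x Ox] := neO; exists x; exact: subset_closure.
have [||V [VE VC cV VB]] := @lipschitz_extension R n.+1 n.+1 K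
  (fun y t => v (y, clamp t)) C B K0 C0 CP.
- move=> e /v_unif[r r0 rP]; exists r => // s t st y Ky.
  by apply: rP => //; rewrite subrr normr0.
- by move=> t y; exact: BP.
- by exists V, C.
Qed.

End field.

(** * The flow *)

Section flow.
Variables (R : realType) (n : nat) (Omega : set 'rV[R]_n.+1)
  (v : 'rV[R]_n.+1 * R -> 'rV[R]_n.+1)
  (V : 'rV[R]_n.+1 -> R -> 'rV[R]_n.+1) (C : R).

Let K := closure Omega.

Hypotheses (oO : open Omega) (cK : compact K)
  (tanv : forall t y, 0 <= t <= 1 -> boundary Omega y ->
    tangent_at (boundary Omega) y (v (y, t)))
  (C0 : 0 <= C) (VE : forall t y, K y -> V y t = v (y, clamp t))
  (VC : forall p q t, `|V p t - V q t| <= C * `|p - q|)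
  (cV : forall x, continuous (V x))
  (VB : forall x, exists B, forall t, `|V x t| <= B).

Lemma tanV t y : boundary Omega y -> tangent_at (boundary Omega) y (V y t).
Proof.
move=> By; rewrite VE; last by case: By.
by apply: tanv => //; exact: clamp_bounds.
Qed.

(** The equation is required on the open interval only: a clamped curve has in general no two-sided
    derivative at 0 and 1, where continuity takes over. *)
Definition trajectory (xi : 'rV[R]_n.+1) (y : R -> 'rV[R]_n.+1) : Prop :=
  [/\ continuous y, y 0 = xi, forall t, K (y t) &
    forall t, 0 < t < 1 -> has_deriv y t (V (y t) t)].

Lemma flow_exists : exists X, is_flow Omega v X.
Proof.
have H xi : exists x : R -> 'rV[R]_n.+1, [/\ continuous x, x 0 = xi &
    forall t, 0 < t -> has_deriv x t (V (x t) t)].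
  have [B VBxi] := VB xi; have [x [cx x0 dx]] := picard C0 VC cV VBxi.
  by exists x; split=> //; exact: x0.
have [X XP] := choice H.
exists X => xi Kxi; have [cx x0 dx] := XP xi.
have stay : forall t, 0 <= t <= 1 -> K (X xi t).
  apply: (stay_closure oO (compact_boundary cK) C0 VC _ cx).
  - by move=> t y _; exact: tanV.
  - by move=> t t01; apply: dx; lra.
  - by rewrite x0.
split=> //; first exact: continuous_subspaceT.
move=> t t01; apply/cvgrPdist_le => e e0.
(* The Picard curve solves the equation beyond time 1, so at [t = 1] too its two-sided derivative
   restricts to the relative one. *)
have [r r0 rP] := dx t (ltac:(lra)) e e0.
have tE : V (X xi t) t = v (X xi t, t).
  by rewrite VE; [rewrite clamp_id //; lra | apply: stay; lra].
rewrite /within /= /dnbhs; apply/nbhs_normP; exists r => // s /= hs st s01.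
rewrite distrC in hs.
have h0 : s - t != 0 by rewrite subr_eq0.
have := rP (s - t) hs; rewrite (addrC t) subrK tE => H1.
rewrite distrC -(ler_pM2l (_ : 0 < `|s - t|)) ?normr_gt0 // -normrZ scalerBr.
by rewrite scalerA mulfV // scale1r mulrC.
Qed.

Lemma flow_trajectory X xi : is_flow Omega v X -> K xi ->
  trajectory xi (fun t => X xi (clamp t)).
Proof.
move=> flowX Kxi; have [Kx cx dx x0] := flowX xi Kxi.
split.
- exact: clamp_continuous.
- by rewrite clamp_id ?lexx ?ler01.
- by move=> t; apply: Kx; exact: clamp_bounds.
move=> t t01.
have tE : clamp t = t by apply: clamp_id; lra.
have KXt : K (X xi t) by apply: Kx; lra.
rewrite tE VE // tE.
suff : has_deriv (X xi) t (v (X xi t, t)).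
  apply: (@has_deriv_near _ _ _ _ _ _ (Num.min t (1 - t))).
    by rewrite lt_min; lra.
  move=> s; rewrite lt_min => /andP[]; rewrite !ltr_norml => h1 h2.
  by rewrite clamp_id //; lra.
move=> e e0; have t01' : 0 < t <= 1 by lra.
have /cvgrPdist_le /(_ e e0) := dx t t01'.
rewrite /within /= /dnbhs => /nbhs_normP[r /= r0 rP].
(* Within this radius [t + h] stays in [[0, 1]], so the relative difference quotient is the full
   one. *)
exists (Num.min r (Num.min t (1 - t))); first by rewrite !lt_min r0; lra.
move=> h; rewrite !lt_min => /and3P[hr ht h1].
have [->|h0] := eqVneq h 0.
  by rewrite addr0 subrr scale0r subrr !normr0 mulr0.
have := rP (t + h); rewrite /= opprD addrA subrr sub0r normrN => /(_ hr).
have th : t + h != t by rewrite -subr_eq0 addrAC subrr add0r.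
move=> /(_ th); rewrite in_itv /= => H.
have {}H := H ltac:(move: ht h1; rewrite !ltr_norml; lra).
rewrite addrAC subrr add0r in H.
rewrite mulrC -ler_pdivrMl ?normr_gt0 //.
move: H; rewrite distrC -(ler_pM2l (_ : 0 < `|h|)) ?normr_gt0 // -normrZ scalerBr.
rewrite scalerA mulfV // scale1r => H.
by rewrite ler_pdivrMl ?normr_gt0.
Qed.

(** Gronwall for the difference of two trajectories; for [xi = xi'] this is uniqueness. *)
Lemma trajectory_close xi xi' y y' : trajectory xi y -> trajectory xi' y' ->
  forall t, 0 <= t <= 1 -> `|y t - y' t| <= `|xi - xi'| * expR (C + 1).
Proof.
move=> [cy y0 _ dy] [cy' y0' _ dy'] t t01.
have := @gronwall_curve R _ (fun t => y t - y' t) 0 1 C 0 _ C0 (lexx _) _ t t01.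
rewrite y0 y0' addr0 subr0 => H.
apply: le_trans (H _ _) _.
- by move=> s; apply: cvgB; [exact: cy | exact: cy'].
- move=> s s01; exists (V (y s) s - V (y' s) s).
    by apply: has_derivB; [exact: dy | exact: dy'].
  by rewrite addr0.
- apply: ler_wpM2l => //; rewrite ler_expR -[leRHS]mulr1.
  by apply: ler_wpM2l; [rewrite addr_ge0 | lra].
Qed.

(** Gronwall for the difference run backward from time 1, where it vanishes. *)
Lemma trajectory_inj xi xi' y y' : trajectory xi y -> trajectory xi' y' ->
  y 1 = y' 1 -> xi = xi'.
Proof.
move=> [cy y0 _ dy] [cy' y0' _ dy'] y1.
have := @gronwall_curve R _ (fun t => y (1 - t) - y' (1 - t)) 0 1 C 0 _ C0
  (lexx _) _ 1 ltac:(by rewrite ler01 lexx).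
rewrite subrr subr0 y1 subrr normr0 addr0 mul0r y0 y0' normr_le0 subr_eq0 => H.
have cont1 : continuous (fun t : R => 1 - t).
  by move=> t; apply: cvgB; [exact: cvg_cst | exact: cvg_id].
apply/eqP; apply: H.
- move=> s; apply: cvgB.
    by apply: (@continuous_comp _ _ _ (fun t : R => 1 - t) y); [exact: cont1 | exact: cy].
  by apply: (@continuous_comp _ _ _ (fun t : R => 1 - t) y'); [exact: cont1 | exact: cy'].
- move=> s s01.
  exists (- V (y (1 - s)) (1 - s) - - V (y' (1 - s)) (1 - s)).
    apply: has_derivB; apply: has_deriv_reverse; [apply: dy | apply: dy']; lra.
  by rewrite addr0 -opprD normrN.
Qed.

Lemma trajectory_open xi y : trajectory xi y -> Omega xi ->
  forall t, 0 <= t <= 1 -> Omega (y t).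
Proof.
move=> [cy y0 _ dy] Oxi; apply: (stay_open oO (compact_boundary cK) C0 VC _ cy dy).
- by move=> t z _; exact: tanV.
- by rewrite y0.
Qed.

(** Solve the reversed equation from [eta]. Tangency being two-sided, the closure is invariant for
    it as well, so its endpoint is an admissible starting point. *)
Lemma trajectory_onto eta : K eta -> exists xi y, [/\ K xi, trajectory xi y & y 1 = eta].
Proof.
move=> Keta; pose V' x t := - V x (1 - t).
have V'C p q t : `|V' p t - V' q t| <= C * `|p - q|.
  by rewrite /V' -opprD normrN.
have cont1 : continuous (fun t : R => 1 - t).
  by move=> t; apply: cvgB; [exact: cvg_cst | exact: cvg_id].
have cV' x : continuous (V' x).
  move=> t; apply: cvgN.
  by apply: (@continuous_comp _ _ _ (fun t : R => 1 - t) (V x)); [exact: cont1 | exact: cV].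
have [B VBeta] := VB eta.
have V'B t : `|V' eta t| <= B by rewrite normrN.
have [z [cz z0 dz]] := picard C0 V'C cV' V'B.
have Kz : forall t, 0 <= t <= 1 -> K (z t).
  apply: (stay_closure oO (compact_boundary cK) C0 V'C _ cz).
  - by move=> t x _ Bx; apply: tangent_atN; exact: tanV.
  - by move=> t t01; apply: dz; lra.
  - by rewrite z0.
exists (z 1), (fun t => z (1 - clamp t)); split.
- by apply: Kz; rewrite ler01 lexx.
- split.
  + apply: (@clamp_continuous _ _ (fun t => z (1 - t))).
    apply: continuous_subspaceT => t.
    by apply: (@continuous_comp _ _ _ (fun t : R => 1 - t) z); [exact: cont1 | exact: cz].
  + by rewrite clamp_id ?lexx ?ler01 // subr0.
  + by move=> t; apply: Kz; have := clamp_bounds t; lra.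
  + move=> t t01; rewrite clamp_id; last by lra.
    apply: (@has_deriv_near _ _ (fun t => z (1 - t)) _ _ _ (Num.min t (1 - t))).
    * by rewrite lt_min; lra.
    * move=> s; rewrite lt_min => /andP[]; rewrite !ltr_norml => h1 h2.
      by rewrite clamp_id //; lra.
    * have := has_deriv_reverse (dz (1 - t) ltac:(lra)).
      rewrite /V' opprK opprB (addrC 1 (t - 1)) subrK; exact.
- by rewrite clamp_id ?lexx ?ler01 // subrr z0.
Qed.

(** * The linearized equation and the differential of the time-one map *)

Variables (g : 'I_n.+1 -> 'rV[R]_n.+1 * R -> 'rV[R]_n.+1) (M : R).
Hypotheses (M0 : 0 <= M)
  (gM : forall x t k, K x -> `|spatial_diff g x (clamp t) k| <= M * `|k|)
  (gU : forall e, 0 < e -> exists2 r, 0 < r &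
    forall x y s t, K x -> K y -> `|x - y| < r -> `|s - t| < r ->
    forall k, `|spatial_diff g x (clamp s) k - spatial_diff g y (clamp t) k| <= e * `|k|)
  (gI : forall a b t c N, 0 < t < 1 -> segment_in Omega a b -> 0 <= N ->
    (forall s, 0 < s < 1 ->
      `|spatial_diff g (a + s *: (b - a)) t (b - a) - c| <= N) ->
    `|v (b, t) - v (a, t) - c| <= N).

(** The equation of variations along [y]. Written with the extensions [g], it makes sense on
    boundary trajectories too. *)
Definition variation (y : R -> 'rV[R]_n.+1) (k : 'rV[R]_n.+1)
    (w : R -> 'rV[R]_n.+1) : Prop :=
  [/\ continuous w, w 0 = k &
    forall t, 0 < t -> has_deriv w t (spatial_diff g (y t) (clamp t) (w t))].

Lemma variation_exists y k : continuous y -> (forall t, K (y t)) ->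
  exists w, variation y k w.
Proof.
move=> cy Ky.
have [|||w [cw w0 dw]] := @picard R n.+1
  (fun w t => spatial_diff g (y t) (clamp t) w) M (M * `|k|) k M0.
- by move=> a b t; rewrite -spatial_diffB; exact: gM.
- move=> x t; apply/continuous_atP => e e0.
  have x0 : 0 < `|x| + 1 by have := normr_ge0 x; lra.
  have [r r0 rP] := gU (divr_gt0 e0 x0).
  have [q q0 qP] := (continuous_atP _ _).1 (cy t) (r / 2) ltac:(by lra).
  exists (Num.min r q); first by rewrite lt_min r0.
  move=> s; rewrite lt_min => /andP[sr sq].
  have ys : `|y s - y t| < r by apply: le_lt_trans (qP s sq) _; lra.
  apply: le_trans (rP (y s) (y t) s t (Ky s) (Ky t) ys sr x) _.
  rewrite mulrAC ler_pdivrMr //; apply: ler_wpM2l; first exact: ltW.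
  lra.
- by move=> t; exact: gM.
- by exists w; split=> //; exact: w0.
Qed.

Lemma variation_bound y k w : (forall t, K (y t)) -> variation y k w ->
  forall t, 0 <= t <= 1 -> `|w t| <= `|k| * expR (M + 1).
Proof.
move=> Ky [cw w0 dw] t t01.
have := @gronwall_curve R _ w 0 1 M 0 cw M0 (lexx _) _ t t01.
rewrite w0 addr0 subr0 => H; apply: le_trans (H _) _.
- move=> s s01; exists (spatial_diff g (y s) (clamp s) (w s)).
    by apply: dw; lra.
  by rewrite addr0; exact: gM.
- apply: ler_wpM2l => //; rewrite ler_expR -[leRHS]mulr1.
  by apply: ler_wpM2l; [rewrite addr_ge0 | lra].
Qed.

(** The difference of two solutions obeys the linear equation up to the change of the coefficients,
    which is small by uniform continuity because the trajectories are close. Starting points on the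
    boundary are included, as the continuous extension of the derivatives requires. *)
Lemma variation_close k e : 0 < e -> exists2 r, 0 < r &
  forall xi xi' y y' w w', trajectory xi y -> trajectory xi' y' ->
    variation y k w -> variation y' k w' -> `|xi - xi'| < r ->
    `|w 1 - w' 1| <= e.
Proof.
move=> e0; pose E := expR (M + 1); have E0 : 0 < E by exact: expR_gt0.
(* One factor [E] bounds [w'], the other comes from Gronwall. *)
pose q := (`|k| + 1) * E * E.
have k0 : 0 < `|k| + 1 by have := normr_ge0 k; lra.
have q0 : 0 < q by rewrite !mulr_gt0.
have [r r0 rP] := gU (divr_gt0 e0 q0).
have EC0 : 0 < expR (C + 1) by exact: expR_gt0.
exists (r / expR (C + 1)); first exact: divr_gt0.
move=> xi xi' y y' w w' ty ty' vw vw'; rewrite ltr_pdivlMr // => xr.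
have [cw w0 dw] := vw; have [cw' w0' dw'] := vw'.
have [_ _ Ky _] := ty; have [_ _ Ky' _] := ty'.
have e1 : 0 <= e / q * (`|k| * E) by rewrite !mulr_ge0 // ?ltW // invr_gt0.
have := @gronwall_curve R _ (fun t => w t - w' t) 0 1 M (e / q * (`|k| * E)) _ M0 e1
  _ 1 ltac:(by rewrite ler01 lexx).
rewrite w0 w0' subrr normr0 add0r subr0 mulr1 -/E => H.
apply: le_trans (H _ _) _.
- by move=> s; apply: cvgB; [exact: cw | exact: cw'].
- move=> s s01.
  exists (spatial_diff g (y s) (clamp s) (w s) - spatial_diff g (y' s) (clamp s) (w' s)).
    by apply: has_derivB; [apply: dw | apply: dw']; lra.
  have -> : spatial_diff g (y s) (clamp s) (w s) - spatial_diff g (y' s) (clamp s) (w' s) =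
      spatial_diff g (y s) (clamp s) (w s - w' s) +
      (spatial_diff g (y s) (clamp s) (w' s) - spatial_diff g (y' s) (clamp s) (w' s)).
    by rewrite spatial_diffB addrA subrK.
  apply: le_trans (ler_normD _ _) _; apply: lerD; first exact: gM.
  have ys : `|y s - y' s| < r.
    by apply: le_lt_trans (trajectory_close ty ty' _) xr; lra.
  apply: le_trans (rP _ _ s s (Ky s) (Ky' s) ys _ _) _; first by rewrite subrr normr0.
  apply: ler_wpM2l; first by rewrite ltW // divr_gt0.
  by apply: (variation_bound Ky' vw'); lra.
- have -> : e / q * (`|k| * E) * E = e / q * (`|k| * E * E) by ring.
  apply: (@le_trans _ _ (e / q * q)).
    apply: ler_wpM2l; first by rewrite ltW // divr_gt0.
    rewrite /q -!mulrA; apply: ler_wpM2r; first by rewrite mulr_ge0 // ltW.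
    lra.
  by rewrite divfK // gt_eqF.
Qed.

(** Compactness of [[0, 1]] gives one radius for all times; segments between neighbouring
    trajectories then stay where [v] is differentiable. *)
Lemma trajectory_margin xi y : trajectory xi y -> Omega xi ->
  exists2 rho, 0 < rho & forall t x, 0 <= t <= 1 -> `|x - y t| < rho -> Omega x.
Proof.
move=> ty Oxi; have [cy _ _ _] := ty.
have /compact_near_coveringP cI := @segment_compact R 0 1.
pose P rho t := forall x, `|x - y t| < rho -> Omega x.
have : \forall rho \near (0 : R)^'+, `[0, 1]%classic `<=` P rho.
  apply: cI => t; rewrite /= in_itv /= => t01.
  have /nbhs_normP[r /= r0 rP] : nbhs (y t) Omega.
    by apply: open_nbhs_nbhs; split=> //; exact: trajectory_open ty Oxi t t01.
  have r20 : 0 < r / 2 by lra.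
  have [q q0 qP] := (continuous_atP _ _).1 (cy t) _ r20.
  exists ([set s | `|s - t| < q], [set rho | rho < r / 2]) => /=.
    by split; [exact: nbhs_norm_lt | exact: nbhs_right_lt].
  move=> [s rho] /= [/qP h1 h2] x h3; apply: rP; rewrite /= distrC.
  have -> : x - y t = (x - y s) + (y s - y t) by rewrite addrA subrK.
  by apply: le_lt_trans (ler_normD _ _) _; lra.
move=> /(filterI (nbhs_right_gt (0 : R))) /filter_ex[rho [rho0 rhoP]].
by exists rho => // t x t01; apply: rhoP; rewrite /= in_itv.
Qed.

(** The error [z] of the linear approximation starts at 0 and solves the linearized equation up to
    the first-order remainder of [v] between two trajectories, which uniform continuity of the
    spatial differential makes small relative to [|k|]. *)
Lemma trajectory_differential (Y : 'rV[R]_n.+1 -> R -> 'rV[R]_n.+1) xi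
    (w : 'I_n.+1 -> R -> 'rV[R]_n.+1) :
  (forall x, K x -> trajectory x (Y x)) -> Omega xi ->
  (forall i, variation (Y xi) (delta_mx 0 i) (w i)) ->
  forall e, 0 < e -> exists2 r, 0 < r & forall k, `|k| < r ->
    `|Y (xi + k) 1 - Y xi 1 - \sum_i k 0 i *: w i 1| <= e * `|k|.
Proof.
move=> tY Oxi vw e e0.
have Kxi : K xi by exact: subset_closure.
have ty := tY xi Kxi; have [cy y0 Ky dy] := ty.
have [rho rho0 rhoP] := trajectory_margin ty Oxi.
pose EC := expR (C + 1); pose EM := expR (M + 1).
have EC0 : 0 < EC by exact: expR_gt0.
have EM0 : 0 < EM by exact: expR_gt0.
have EC1 : 1 <= EC by rewrite -[leLHS]expR0 ler_expR addr_ge0.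
(* [EC] bounds the spreading of the trajectories, [EM] is the Gronwall factor for [z]. *)
have q0 : 0 < e / (EC * EM) by rewrite divr_gt0 // mulr_gt0.
have [r r0 rP] := gU q0.
have m0 : 0 < Num.min rho r by rewrite lt_min rho0.
exists (Num.min rho r / EC); first exact: divr_gt0.
move=> k; rewrite ltr_pdivlMr // lt_min => /andP[k1 k2].
have Ok : Omega (xi + k).
  apply: (rhoP 0); first by rewrite lexx ler01.
  rewrite y0 addrAC subrr add0r; apply: le_lt_trans k1.
  by rewrite -[leLHS]mulr1; apply: ler_wpM2l.
have tb := tY _ (subset_closure Ok); have [cb b0 Kb db] := tb.
have by_ t : 0 <= t <= 1 -> `|Y (xi + k) t - Y xi t| <= `|k| * EC.
  by move=> t01; have := trajectory_close tb ty t01; rewrite addrAC subrr add0r.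
pose z t := Y (xi + k) t - Y xi t - \sum_i k 0 i *: w i t.
have cz : continuous z.
  move=> t; apply: cvgB; first by apply: cvgB; [exact: cb | exact: cy].
  apply: (@continuous_big _ _ _ _ _ _ _ _ (fun i t => k 0 i *: w i t)).
    exact: add_continuous.
  by move=> i _ s; have [cw _ _] := vw i; apply: cvgZr; exact: cw.
have z0 : z 0 = 0.
  rewrite /z y0 b0 (addrAC xi) subrr add0r {1}[k]row_sum_delta -sumrB big1 // => i _.
  by have [_ -> _] := vw i; rewrite subrr.
have N0 : 0 <= e / (EC * EM) * (`|k| * EC).
  by rewrite !mulr_ge0 // ?invr_ge0 ?mulr_ge0 // ltW.
have := @gronwall_curve R _ z 0 1 M _ cz M0 N0 _ 1 ltac:(by rewrite ler01 lexx).
rewrite z0 normr0 add0r subr0 mulr1 -/EM => H; apply: le_trans (H _) _; last first.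
  have -> : e / (EC * EM) * (`|k| * EC) * EM = e / (EC * EM) * (EC * EM) * `|k| by ring.
  by rewrite divfK // gt_eqF // mulr_gt0.
move=> t t01; have tE : clamp t = t by apply: clamp_id; lra.
exists (V (Y (xi + k) t) t - V (Y xi t) t -
    \sum_i k 0 i *: spatial_diff g (Y xi t) (clamp t) (w i t)).
  apply: has_derivB; first by apply: has_derivB; [exact: db | exact: dy].
  apply: has_deriv_sum => i; apply: has_derivZ; have [_ _ dw] := vw i.
  by apply: dw; lra.
rewrite -spatial_diff_sum !VE // tE.
set a := Y xi t; set b := Y (xi + k) t.
have -> : v (b, t) - v (a, t) - spatial_diff g a t (\sum_i k 0 i *: w i t) =
    (v (b, t) - v (a, t) - spatial_diff g a t (b - a)) + spatial_diff g a t (z t).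
  have -> : spatial_diff g a t (z t) =
      spatial_diff g a t (b - a) - spatial_diff g a t (\sum_i k 0 i *: w i t).
    by rewrite -spatial_diffB.
  by rewrite addrA subrK.
rewrite addrC [leRHS]addrC addrC; apply: le_trans (ler_normD _ _) _.
apply: lerD; last by have := gM t (z t) (Ky t); rewrite tE.
have ba := by_ t ltac:(by lra); rewrite -/a -/b in ba.
have seg s : 0 <= s <= 1 -> `|a + s *: (b - a) - a| <= `|k| * EC.
  move=> s01; rewrite addrAC subrr add0r normrZ ger0_norm; last by lra.
  by apply: le_trans ba; rewrite -[leRHS]mul1r; apply: ler_wpM2r => //; lra.
have segO : segment_in Omega a b.
  move=> s s01; apply: (rhoP t); first by lra.
  exact: le_lt_trans (seg s s01) k1.
apply: gI => // s s01.
rewrite -tE; apply: (@le_trans _ _ (e / (EC * EM) * `|b - a|)).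
  apply: rP => //; first by apply: subset_closure; apply: segO; lra.
  - exact: Ky.
  - by apply: le_lt_trans (seg s _) k2; lra.
  - by rewrite subrr normr0.
by apply: ler_wpM2l => //; exact: ltW.
Qed.

Lemma trajectory_C1 (Y : 'rV[R]_n.+1 -> R -> 'rV[R]_n.+1) :
  (forall x, K x -> trajectory x (Y x)) ->
  C1_closure Omega (fun x => Y x 1).
Proof.
move=> tY.
(* Solutions are chosen at boundary points as well; outside [K] the choice is arbitrary. *)
have exw (p : 'rV[R]_n.+1 * 'I_n.+1) : exists w,
    K p.1 -> variation (Y p.1) (delta_mx 0 p.2) w.
  have [Kp|nK] := pselect (K p.1); last by exists (fun=> 0).
  have [cy _ Ky _] := tY _ Kp.
  by have [w wP] := variation_exists (delta_mx 0 p.2) cy Ky; exists w.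
have [W WP] := choice exw.
have vW x i : K x -> variation (Y x) (delta_mx 0 i) (W (x, i)) by exact: WP (x, i).
pose J x := \matrix_i W (x, i) 1.
have JE x k : k *m J x = \sum_i k 0 i *: W (x, i) 1.
  by rewrite mulmx_sum_row; apply: eq_bigr => i _; rewrite rowK.
have diffP x : Omega x -> differentiable (fun x => Y x 1) x /\
    forall k, 'd (fun x => Y x 1) x k = k *m J x.
  move=> Ox.
  have cJ : continuous (mulmxr (J x) : 'rV[R]_n.+1 -> 'rV[R]_n.+1).
    move=> k; apply/continuous_atP => e e0.
    have [D D1 DP] := mulmx_norm_bound (J x).
    have D0 : 0 < D by lra.
    exists (e / D) => [|l]; first exact: divr_gt0.
    rewrite ltr_pdivlMr // => /ltW le; rewrite /= -mulmxBl.
    by apply: le_trans (DP _) _; rewrite mulrC.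
  have dE := @diff_unique R _ _ (fun x => Y x 1) (mulmxr (J x)) x cJ.
  have exp : (fun x => Y x 1) \o shift x = cst (Y x 1) + mulmxr (J x) +o_ (0 : 'rV[R]_n.+1) id.
    apply/eqaddoP => e e0.
    have [r r0 rP] := trajectory_differential tY Ox
      (fun i => vW x i (subset_closure Ox)) e0.
    apply: filterS (nbhs_norm_lt (0 : 'rV[R]_n.+1) r0) => k /=; rewrite subr0 => /rP.
    rewrite -JE => H; rewrite [X in `|X|](_ : _ = Y (x + k) 1 - Y x 1 - k *m J x) //.
    by rewrite (addrC x) -addrA -opprD.
  have {}dE := dE exp.
  split; last by move=> k; rewrite dE.
  by apply/diff_locallyP; rewrite dE.
split.
- apply/within_continuousP => x Kx e e0.
  have E0 : 0 < expR (C + 1) by exact: expR_gt0.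
  exists (e / expR (C + 1)); first exact: divr_gt0.
  move=> y Ky; rewrite ltr_pdivlMr // => xy.
  by apply: le_trans (trajectory_close (tY y Ky) (tY x Kx) _) (ltW xy); rewrite ler01 lexx.
- by move=> x Ox; have [] := diffP x Ox.
(* The extension of the derivative along [h] is again given by [J], which is defined on all of
   [K]. *)
move=> h; exists (fun x => h *m J x); last first.
  by move=> x Ox; have [dx <-] := diffP x Ox; rewrite deriveE.
apply/within_continuousP => x Kx e e0.
have e'0 : 0 < e / (`|h| + 1) / n.+1%:R.
  by rewrite !divr_gt0 //; have := normr_ge0 h; lra.
have H i : exists r, 0 < r /\ forall y, K y -> `|y - x| < r ->
    `|W (y, i) 1 - W (x, i) 1| <= e / (`|h| + 1) / n.+1%:R.
  have [r r0 rP] := variation_close (delta_mx 0 i) e'0.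
  exists r; split=> // y Ky yx.
  exact: rP (tY y Ky) (tY x Kx) (vW y i Ky) (vW x i Kx) yx.
have [r rP] := choice H.
exists (\big[Num.min/1]_i r i); first by apply: lt_bigmin => // i _; have [] := rP i.
move=> y Ky yx; rewrite !JE -sumrB; apply: le_trans (ler_norm_sum _ _ _) _.
apply: (@le_trans _ _ (\sum_(i < n.+1) (`|h| + 1) * (e / (`|h| + 1) / n.+1%:R))).
  apply: ler_sum => i _; rewrite -scalerBr normrZ; apply: ler_pM => //.
    by have := ler_norm_coord h i; lra.
  have [_ riP] := rP i; apply: riP => //; apply: lt_le_trans yx _.
  exact: bigmin_le_cond.
rewrite sumr_const card_ord -mulrnAr -mulr_natr divfK ?pnatr_eq0 //.
by rewrite mulrC divfK // gt_eqF //; have := normr_ge0 h; lra.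
Qed.

End flow.

Theorem proposition3p2 (R : realType) (n : nat) (Omega : set 'rV[R]_n.+1)
    (hbounded : bounded_set Omega) (hlip : lipschitz_domain Omega)
    (v : 'rV[R]_n.+1 * R -> 'rV[R]_n.+1) (hv : V0 Omega v) :
  Diff Omega (time_one_map Omega v).
Proof.
have [oO _ neO charts] := hlip.
have [[cv dv exg] hnu] := hv.
have exg' i : exists g : 'rV[R]_n.+1 * R -> 'rV[R]_n.+1,
    {within closure (Omega `*` [set t : R | 0 < t < 1]), continuous g} /\
    forall x, (Omega `*` [set t : R | 0 < t < 1]) x -> 'D_(delta_mx 0 i, 0) v x = g x.
  by have [g cg Dg] := exg (delta_mx 0 i, 0); exists g.
have [g gP] := choice exg'.
have cg i := (gP i).1; have Dg i := (gP i).2.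
have cK := bounded_closure_compact hbounded.
have [V [C [C0 VE VC cV VB]]] := v_extension oO hbounded neO charts cv dv cg Dg.
have [M M0 MP] := spatial_diff_bound hbounded cg.
have tanv t y : 0 <= t <= 1 -> boundary Omega y ->
    tangent_at (boundary Omega) y (v (y, t)).
  move=> t01 By.
  (* Applied at the fixed time [t], with the null set belonging to that time. *)
  apply: (@tangent_everywhere R n Omega (fun x => v (x, t)) _ oO charts _ (hnu t t01)) By.
  - move=> p Bp e e0; have [r r0 rP] := v_unif hbounded cv e0.
    exists r => // x Bx xp.
    have := rP x p t t Bx.1 Bp.1 xp; rewrite subrr normr0 clamp_id //; exact.
  - move=> x Bx [nu xnu vnu]; exact: normal_orthogonal_tangent xnu vnu.
have [X flowX] := flow_exists oO cK tanv C0 VE VC cV VB.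
(* [time_one_map] uses whichever flow [get] selects; existence guarantees that it selects one, and
   the rest holds for any flow. *)
have [Y [flowY Y1]] : exists Y : 'rV[R]_n.+1 -> R -> 'rV[R]_n.+1,
    is_flow Omega v Y /\ time_one_map Omega v = fun x => Y x (clamp 1).
  exists (get (is_flow Omega v : set ('rV[R]_n.+1 -> R -> 'rV[R]_n.+1))).
  split; first exact: (getI flowX).
  by apply/funext => x; rewrite /time_one_map clamp_id ?lexx ?ler01.
have tY x : closure Omega x -> trajectory Omega V x (fun t => Y x (clamp t)).
  by move=> Kx; exact: (flow_trajectory VE flowY Kx).
rewrite Y1; split.
- have gU := @spatial_diff_unif R n Omega g hbounded cg.
  have gI := v_increment hbounded cv dv Dg.
  have H := trajectory_C1 oO cK tanv C0 VE VC M0 MP gU gI tY.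
  exact: H.
split.
- by move=> x Kx; have [_ _ + _] := tY x Kx; apply.
- move=> x x' /set_mem Kx /set_mem Kx' e.
  have inj := trajectory_inj C0 VC (tY x Kx) (tY x' Kx').
  exact: inj e.
(* The trajectory ending at [eta] is not given as the one of the selected flow; uniqueness
   identifies the two at time 1. *)
- move=> eta Keta.
  have [xi [y [Kxi ty y1]]] := trajectory_onto oO cK tanv C0 VE VC cV VB Keta.
  exists xi => //=; rewrite -y1; apply/eqP; rewrite -subr_eq0 -normr_le0.
  have := trajectory_close C0 VC (tY xi Kxi) ty (_ : 0 <= 1 <= 1).
  by rewrite subrr normr0 mul0r; apply; rewrite ler01 lexx.
Qed.
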